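(* An $\epsilon$-simplicial set $X$ is isomorphic to $N(\mathcal{F})$ for some Frobenius algebra $\mathcal{F}$ in $\mathbf{Rel}$ if and only if $X$ has the unique extension property with respect to (i) the inclusions $\Lambda^n_{\epsilon,0}\subset \Delta_\epsilon^n$ and $\Lambda^n_{\epsilon,n}\subset \Delta_\epsilon^n$ for all $n\geq 1$, (ii) the inclusions $\partial\Delta^n\subset \Delta^n$ for all $n\geq 3$, and $X$ has the extension property with respect to (iii) the inclusion $\partial_1\Delta_\epsilon^4\cup\partial_3\Delta_\epsilon^4\hookrightarrow\Delta_\epsilon^4$.
   Context: **Monoids and Frobenius algebras in $\mathbf{Rel}$.** $\mathbf{Rel}$ is the category of sets and binary relations, monoidal under the cartesian product $\times$ with unit a one-element set $\{\bullet\}$. A relation from $A$ to $B$ is written $R\colon A\dashrightarrow B$, and $R\colon a\dashrightarrow b$ means that $a$ is $R$-related to $b$. Relations $\{\bullet\}\dashrightarrow F$ and $F\dashrightarrow\{\bullet\}$ are identified with subsets of $F$. A monoid in $\mathbf{Rel}$ is a triple $(F;\mu,\eta)$ with relations $\mu\colon F\times F\dashrightarrow F$, $\eta\colon\{\bullet\}\dashrightarrow F$ such that $\mu\circ(\mu\times\mathrm{id})=\mu\circ(\mathrm{id}\times\mu)$ and $\mu\circ(\eta\times\mathrm{id})=\mathrm{id}=\mu\circ(\mathrm{id}\times\eta)$. A comonoid $(F;\delta,\epsilon)$ has $\delta\colon F\dashrightarrow F\times F$, $\epsilon\colon F\dashrightarrow\{\bullet\}$ with $(\delta\times\mathrm{id})\circ\delta=(\mathrm{id}\times\delta)\circ\delta$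 and $(\epsilon\times\mathrm{id})\circ\delta=\mathrm{id}=(\mathrm{id}\times\epsilon)\circ\delta$. A Frobenius algebra in $\mathbf{Rel}$ is $\mathcal{F}=(F;\mu,\eta,\delta,\epsilon)$ with $(F;\mu,\eta)$ a monoid, $(F;\delta,\epsilon)$ a comonoid, and $(\mu\times\mathrm{id})\circ(\mathrm{id}\times\delta)=\delta\circ\mu=(\mathrm{id}\times\mu)\circ(\delta\times\mathrm{id})$. A homomorphism of monoids $(F_1;\mu_1,\eta_1)\to(F_2;\mu_2,\eta_2)$ is a mapping $h\colon F_1\to F_2$ such that $a\in\eta_1$ implies $h(a)\in\eta_2$, and $\mu_1\colon(a,b)\dashrightarrow c$ implies $\mu_2\colon(h(a),h(b))\dashrightarrow h(c)$. **$\epsilon$-simplicial sets.** $\Delta$ is the category of finite chains $[n]=\{0<\dots<n\}$ and non-decreasing maps. $\Delta_\epsilon$ is the category obtained from $\Delta$ by freely adding one object $[\epsilon]$, one arrow $w\colon[1]\to[\epsilon]$, and the induced compositions. An $\epsilon$-simplicial set is a presheaf of sets on $\Delta_\epsilon$; equivalently, a simplicial set $X$ together with a set $X_\epsilon$ and a map $X_\epsilon\to X_1$. A simplicial set is regarded as an $\epsilon$-simplicial set with $X_\epsilon=\emptyset$. Edges in the image of $X_\epsilon\to X_1$ are called $\epsilon$-edges (marked edges). For $n\ge1$, $\Delta_\epsilon^n$ is the $\epsilon$-simplicial set with underlying simplicial set the standard simplex $\Delta^n$ and $(\Delta_\epsilon^n)_\epsilon$ a one-element set mapped to the edge from $0$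 to $n$. $\partial_i\Delta_\epsilon^n\subset\Delta_\epsilon^n$ is the codimension-one face opposite the vertex $i$, where the marked edge remains marked if it belongs to the face. $\Lambda^n_{\epsilon,i}=\bigcup_{j\neq i}\partial_j\Delta_\epsilon^n$. $\partial\Delta^n$ is the boundary of $\Delta^n$ (no marked edges). **Extension property.** $X$ has the (unique) extension property with respect to $m\colon A\to B$ if every morphism $A\to X$ of $\epsilon$-simplicial sets factors as (a unique morphism) $B\to X$ precomposed with $m$. **Nerve.** The chain $[n]$ is viewed as a monoid in $\mathbf{Rel}$ (from the corresponding small category): elements are pairs $(i,j)$ with $0\le i\le j\le n$, units are the pairs $(i,i)$, and $\mu\colon((j,k),(i,j))\dashrightarrow(i,k)$ are the only related elements. For a Frobenius algebra $\mathcal{F}=(F;\mu,\eta,\delta,\epsilon)$, $N(\mathcal{F})$ is the $\epsilon$-simplicial set whose $n$-simplices are the monoid homomorphisms $[n]\to(F;\mu,\eta)$ (so $N(\mathcal{F})_1$ is identified with $F$, and $2$-simplices are triples $(a,b,c)$ with $\mu\colon(a,b)\dashrightarrow c$, where $a$ is the edge $12$, $b$ the edge $01$, $c$ the edge $02$), with $N(\mathcal{F})_\epsilon=\epsilon\subseteq F$ and the map $N(\mathcal{F})_\epsilon\to N(\mathcal{F})_1=F$ the inclusion. *)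

(* Defs.v *)
(* Relations, homomorphisms and morphisms are compared by Leibniz equality, which
   is extensional thanks to the axioms of mathcomp.classical.boolp. *)
From HB Require Import structures.
From mathcomp Require Import all_boot.
From mathcomp Require Import boolp.

Set Implicit Arguments.
Unset Strict Implicit.
Unset Printing Implicit Defensive.

Definition hrel (A B : Type) := A -> B -> Prop.

Definition rid (A : Type) : hrel A A := fun a b => a = b.

Definition rcomp (A B C : Type) (S : hrel B C) (R : hrel A B) : hrel A C :=
  fun a c => exists b, R a b /\ S b c.

Definition rprod (A B C D : Type) (R : hrel A B) (S : hrel C D) :
    hrel (A * C) (B * D) :=
  fun p q => R p.1 q.1 /\ S p.2 q.2.

Definition graph (A B : Type) (f : A -> B) : hrel A B := fun a b => f a = b.

Notation "S \oR R" := (rcomp S R) (at level 50, left associativity).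
Notation "R \xR S" := (rprod R S) (at level 40, left associativity).

(* The coherence isomorphisms are left implicit in the usual equations; here
   they are the graphs of the evident bijections. *)
Definition rassoc (A B C : Type) : hrel (A * B * C) (A * (B * C)) :=
  graph (fun p => (p.1.1, (p.1.2, p.2))).
Definition rassoc_inv (A B C : Type) : hrel (A * (B * C)) (A * B * C) :=
  graph (fun p => (p.1, p.2.1, p.2.2)).
Definition lunit (A : Type) : hrel (unit * A) A := graph snd.
Definition runit (A : Type) : hrel (A * unit) A := graph fst.
Definition lunit_inv (A : Type) : hrel A (unit * A) := graph (fun a => (tt, a)).
Definition runit_inv (A : Type) : hrel A (A * unit) := graph (fun a => (a, tt)).

Arguments rid {A}.
Arguments rassoc {A B C}.
Arguments rassoc_inv {A B C}.
Arguments lunit {A}.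
Arguments runit {A}.
Arguments lunit_inv {A}.
Arguments runit_inv {A}.

Record is_monoid (F : Type) (mu : hrel (F * F) F) (eta : hrel unit F) : Prop :=
  IsMonoid {
    monoidA : mu \oR (mu \xR rid) = mu \oR (rid \xR mu) \oR rassoc;
    monoid1l : mu \oR (eta \xR rid) = lunit;
    monoid1r : mu \oR (rid \xR eta) = runit }.

Record is_comonoid (F : Type) (delta : hrel F (F * F)) (eps : hrel F unit) :
    Prop :=
  IsComonoid {
    comonoidA : rassoc \oR (delta \xR rid) \oR delta = (rid \xR delta) \oR delta;
    comonoid1l : (eps \xR rid) \oR delta = lunit_inv;
    comonoid1r : (rid \xR eps) \oR delta = runit_inv }.

Record rmonoid := RMonoid {
  rmcar :> Type;
  rmul : hrel (rmcar * rmcar) rmcar;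
  rone : hrel unit rmcar;
  rmonoidP : is_monoid rmul rone }.

Arguments rmul : clear implicits.
Arguments rone : clear implicits.

Record frobenius := Frobenius {
  frob_monoid :> rmonoid;
  rcomul : hrel frob_monoid (frob_monoid * frob_monoid);
  rcounit : hrel frob_monoid unit;
  rcomonoidP : is_comonoid rcomul rcounit;
  frobenius_l :
    (rmul frob_monoid \xR rid) \oR rassoc_inv \oR (rid \xR rcomul)
      = rcomul \oR rmul frob_monoid;
  frobenius_r :
    (rid \xR rmul frob_monoid) \oR rassoc \oR (rcomul \xR rid)
      = rcomul \oR rmul frob_monoid }.

Arguments rcomul : clear implicits.
Arguments rcounit : clear implicits.

Record rmhom (M N : rmonoid) := RMHom {
  rmfun :> M -> N;
  rmhom1 : forall a, rone M tt a -> rone N tt (rmfun a);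
  rmhomM : forall a b c, rmul M (a, b) c -> rmul N (rmfun a, rmfun b) (rmfun c) }.

Lemma rmhom_ext (M N : rmonoid) (h k : rmhom M N) : (forall a, h a = k a) -> h = k.
Proof.
case: h k => [h h1 hM] [k k1 kM] /= /funext hk; subst k.
by congr RMHom; exact: Prop_irrelevance.
Qed.

Definition rmhom_comp (M N P : rmonoid) (h : rmhom N P) (k : rmhom M N) :
    rmhom M P :=
  RMHom (fun a ka => rmhom1 h (rmhom1 k ka))
        (fun a b c kabc => rmhomM h (rmhomM k kabc)).

Record delta (m n : nat) := Delta {
  dfun :> {ffun 'I_m.+1 -> 'I_n.+1};
  _ : [forall i : 'I_m.+1, forall j : 'I_m.+1, (i <= j) ==> (dfun i <= dfun j)] }.

HB.instance Definition _ m n := [isSub for @dfun m n].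

Lemma delta_le m n (f : delta m n) (i j : 'I_m.+1) : i <= j -> f i <= f j.
Proof. by move=> ij; exact: (implyP (forallP (forallP (valP f) i) j)). Qed.

Lemma delta_ext m n (f g : delta m n) : (forall i, f i = g i) -> f = g.
Proof. by move=> fg; apply/val_inj/ffunP. Qed.

Lemma mk_delta_subproof m n (f : 'I_m.+1 -> 'I_n.+1)
    (fle : forall i j : 'I_m.+1, i <= j -> f i <= f j) :
  [forall i : 'I_m.+1, forall j : 'I_m.+1,
    (i <= j) ==> (finfun f i <= finfun f j)].
Proof.
by apply/forallP => i; apply/forallP => j; apply/implyP => /fle; rewrite !ffunE.
Qed.

Definition mk_delta m n (f : 'I_m.+1 -> 'I_n.+1)
    (fle : forall i j : 'I_m.+1, i <= j -> f i <= f j) : delta m n :=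
  Delta (mk_delta_subproof fle).

Lemma mk_deltaE m n f fle i : @mk_delta m n f fle i = f i.
Proof. exact: ffunE. Qed.

Definition delta_id n : delta n n := mk_delta (fun i j (ij : i <= j) => ij).

Definition delta_comp l m n (g : delta m n) (f : delta l m) : delta l n :=
  mk_delta (fun i j (ij : i <= j) => delta_le g (delta_le f ij)).

Lemma delta_idE n i : delta_id n i = i.
Proof. exact: mk_deltaE. Qed.

Lemma delta_compE l m n (g : delta m n) (f : delta l m) i :
  delta_comp g f i = g (f i).
Proof. exact: mk_deltaE. Qed.

Record sset := SSet {
  simplices :> nat -> Type;
  act : forall m n, delta m n -> simplices n -> simplices m;
  act_id : forall n (x : simplices n), act (delta_id n) x = x;
  act_comp : forall l m n (g : delta m n) (f : delta l m) (x : simplices n),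
    act (delta_comp g f) x = act f (act g x) }.

(* [marks X] is the value at the additional object [epsilon], and [mark_edge]
   the action of the additional arrow w : [1] -> [epsilon]. *)
Record eset := ESet {
  eset_sset :> sset;
  marks : Type;
  mark_edge : marks -> eset_sset 1 }.

Arguments mark_edge {X} _ : rename.

Record emor (X Y : eset) := EMor {
  emor_simp : forall n, X n -> Y n;
  emor_mark : marks X -> marks Y;
  emor_act : forall m n (f : delta m n) (x : X n),
    emor_simp (act f x) = act f (emor_simp x);
  emor_edge : forall e, emor_simp (mark_edge e) = mark_edge (emor_mark e) }.

Arguments emor_simp {X Y} _ {n} _.
Arguments emor_mark {X Y}.

Lemma emor_ext (X Y : eset) (f g : emor X Y) :
  (forall n (x : X n), emor_simp f x = emor_simp g x) ->
  (forall e, emor_mark f e = emor_mark g e) -> f = g.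
Proof.
case: f g => [f fe fA fE] [g ge gA gE] /= fg fge.
have {}fg : f = g by apply: functional_extensionality_dep => n; exact/funext.
have {}fge : fe = ge by exact/funext.
by subst g ge; congr EMor; exact: Prop_irrelevance.
Qed.

Definition emor_id (X : eset) : emor X X :=
  @EMor X X (fun _ x => x) (fun e => e)
    (fun _ _ _ _ => erefl) (fun _ => erefl).

Lemma emor_comp_act (X Y Z : eset) (g : emor Y Z) (f : emor X Y)
    m n (d : delta m n) (x : X n) :
  emor_simp g (emor_simp f (act d x)) = act d (emor_simp g (emor_simp f x)).
Proof. by rewrite !emor_act. Qed.

Lemma emor_comp_edge (X Y Z : eset) (g : emor Y Z) (f : emor X Y) e :
  emor_simp g (emor_simp f (mark_edge e))
    = mark_edge (emor_mark g (emor_mark f e)).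
Proof. by rewrite !emor_edge. Qed.

Definition emor_comp (X Y Z : eset) (g : emor Y Z) (f : emor X Y) : emor X Z :=
  EMor (emor_comp_act g f) (emor_comp_edge g f).

Definition eset_iso (X Y : eset) : Prop :=
  exists (f : emor X Y) (g : emor Y X),
    emor_comp g f = emor_id X /\ emor_comp f g = emor_id Y.

Definition extension_property (X A B : eset) (m : emor A B) : Prop :=
  forall f : emor A X, exists g : emor B X, emor_comp g m = f.

Definition unique_extension_property (X A B : eset) (m : emor A B) : Prop :=
  forall f : emor A X, exists! g : emor B X, emor_comp g m = f.

Record subeset (X : eset) := SubESet {
  in_simp : forall n, X n -> bool;
  in_mark : marks X -> bool;
  in_act : forall m n (f : delta m n) (x : X n),
    in_simp x -> in_simp (act f x);
  in_edge : forall e, in_mark e -> in_simp (mark_edge e) }.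

Arguments in_simp {X} s {n}.
Arguments in_mark {X}.

Section SubESetTheory.
Variables (X : eset) (S : subeset X).

Definition sub_simplices n := {x : X n | in_simp S x}.

Definition sub_act m n (f : delta m n) (x : sub_simplices n) : sub_simplices m :=
  exist _ (act f (sval x)) (in_act f (svalP x)).

Lemma sub_act_id n (x : sub_simplices n) : sub_act (delta_id n) x = x.
Proof. by case: x => x xS; apply: eq_exist; exact: act_id. Qed.

Lemma sub_act_comp l m n (g : delta m n) (f : delta l m) (x : sub_simplices n) :
  sub_act (delta_comp g f) x = sub_act f (sub_act g x).
Proof. by case: x => x xS; apply: eq_exist; exact: act_comp. Qed.

Definition sub_sset : sset := SSet sub_act_id sub_act_comp.

Definition sub_mark_edge (e : {e : marks X | in_mark S e}) : sub_sset 1 :=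
  exist _ (mark_edge (sval e)) (in_edge (svalP e)).

Definition sub_eset : eset := ESet sub_mark_edge.

Definition sub_incl : emor sub_eset X :=
  @EMor sub_eset X (fun _ x => sval x) (fun e => sval e)
    (fun _ _ _ _ => erefl) (fun _ => erefl).

End SubESetTheory.

Section BigUnion.
Variables (X : eset) (I : finType) (P : pred I) (S : I -> subeset X).

Definition big_in_simp n (x : X n) := [exists i, P i && in_simp (S i) x].
Definition big_in_mark (e : marks X) := [exists i, P i && in_mark (S i) e].

Lemma big_in_act m n (f : delta m n) (x : X n) :
  big_in_simp x -> big_in_simp (act f x).
Proof.
by case/existsP=> i /andP[Pi xi]; apply/existsP; exists i; rewrite Pi in_act.
Qed.

Lemma big_in_edge e : big_in_mark e -> big_in_simp (mark_edge e).
Proof.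
by case/existsP=> i /andP[Pi ei]; apply/existsP; exists i; rewrite Pi in_edge.
Qed.

Definition sub_bigcup : subeset X := SubESet big_in_act big_in_edge.

End BigUnion.

Section Union.
Variables (X : eset) (S T : subeset X).

Lemma cup_in_act m n (f : delta m n) (x : X n) :
  in_simp S x || in_simp T x -> in_simp S (act f x) || in_simp T (act f x).
Proof. by case/orP => /(in_act f) ->; rewrite ?orbT. Qed.

Lemma cup_in_edge e :
  in_mark S e || in_mark T e ->
  in_simp S (mark_edge e) || in_simp T (mark_edge e).
Proof. by case/orP => /in_edge ->; rewrite ?orbT. Qed.

Definition sub_cup : subeset X := SubESet cup_in_act cup_in_edge.

End Union.

Lemma delta_comp1 m n (f : delta m n) : delta_comp f (delta_id m) = f.
Proof. by apply: delta_ext => i; rewrite delta_compE delta_idE. Qed.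

Lemma delta_compA k l m n (h : delta m n) (g : delta l m) (f : delta k l) :
  delta_comp h (delta_comp g f) = delta_comp (delta_comp h g) f.
Proof. by apply: delta_ext => i; rewrite !delta_compE. Qed.

Definition std_sset (n : nat) : sset :=
  @SSet (fun m => delta m n) (fun l m f x => delta_comp x f)
    (fun m x => delta_comp1 x) (fun k l m g f x => delta_compA x g f).

Definition unmarked (X : sset) : eset :=
  @ESet X void (fun e => match e with end).

Definition std_simplex (n : nat) : eset := unmarked (std_sset n).

Lemma long_edge_le n (i j : 'I_2) :
  i <= j -> (if i == ord0 then ord0 else ord_max : 'I_n.+1)
         <= (if j == ord0 then ord0 else ord_max : 'I_n.+1).
Proof.
have [//|i0] := eqVneq i ord0; have [-> i_le0|//] := eqVneq j ord0.
by move: i0; rewrite -(inj_eq val_inj) -leqn0 i_le0.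
Qed.

Definition long_edge n : delta 1 n := mk_delta (@long_edge_le n).

Definition std_esimplex (n : nat) : eset :=
  @ESet (std_sset n) unit (fun _ => long_edge n).

(* A simplex f : [m] -> [n] lies in the face opposite i iff it misses i. *)
Definition misses m n (i : 'I_n.+1) (f : delta m n) : bool :=
  [forall k, f k != i].

Lemma misses_comp l m n (i : 'I_n.+1) (f : delta l m) (x : delta m n) :
  misses i x -> misses i (delta_comp x f).
Proof. by move=> /forallP xi; apply/forallP => k; rewrite delta_compE xi. Qed.

Definition face n (i : 'I_n.+1) : subeset (std_simplex n) :=
  @SubESet (std_simplex n) (fun m f => misses i f) (fun _ => false)
    (fun l m f x => @misses_comp l m n i f x)
    (fun e => match e with end).

Definition eface n (i : 'I_n.+1) : subeset (std_esimplex n) :=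
  @SubESet (std_esimplex n) (fun m f => misses i f)
    (fun _ => misses i (long_edge n))
    (fun l m f x => @misses_comp l m n i f x)
    (fun _ h => h).

Definition boundary n : subeset (std_simplex n) := sub_bigcup predT (@face n).

Definition ehorn n (i : 'I_n.+1) : subeset (std_esimplex n) :=
  sub_bigcup (fun j => j != i) (@eface n).

Section Chain.
Variable n : nat.

Definition chain_arrow := {p : 'I_n.+1 * 'I_n.+1 | p.1 <= p.2}.

Definition chain_mul : hrel (chain_arrow * chain_arrow) chain_arrow :=
  fun pq r => [/\ (sval pq.2).2 = (sval pq.1).1,
                  (sval r).1 = (sval pq.2).1 & (sval r).2 = (sval pq.1).2].

Definition chain_one : hrel unit chain_arrow :=
  fun _ p => (sval p).1 = (sval p).2.

Lemma chain_arrow_ext (p q : chain_arrow) :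
  (sval p).1 = (sval q).1 -> (sval p).2 = (sval q).2 -> p = q.
Proof.
by case: p q => [[i j] ij] [[k l] kl] /= ik jl; apply: eq_exist; rewrite ik jl.
Qed.

Definition mk_arrow (i j : 'I_n.+1) (ij : i <= j) : chain_arrow :=
  exist (fun p : 'I_n.+1 * 'I_n.+1 => is_true (p.1 <= p.2)) (i, j) ij.

Lemma chain_monoid : is_monoid chain_mul chain_one.
Proof.
split.
- apply/funext => -[[p q] r]; apply/funext => s; rewrite propeqE; split.
  + case=> -[x _] /= [[/= [qp x1 x2] <-]] [/= rx s1 s2].
    have rq : (sval r).1 <= (sval q).2.
      by rewrite (leq_trans (svalP r)) // rx x1 (svalP q).
    exists (p, (q, r)); split; first by [].
    exists (p, mk_arrow rq); split; first by split=> //; split=> //=; rewrite rx.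
    by split=> //=; rewrite s2 x2.
  + case=> _ [<-] /= [[_ y] [[/= <- [/= rq y1 y2]] [/= yp s1 s2]]].
    have qp : (sval q).1 <= (sval p).2.
      by rewrite (leq_trans (svalP q)) // -y2 yp (svalP p).
    exists (mk_arrow qp, r); split; first by split=> //; split=> //=; rewrite -yp.
    by split=> //=; rewrite s1 y1.
- apply/funext => -[[] q]; apply/funext => s; rewrite propeqE; split.
  + case=> -[u _] /= [[/= u1 <-]] [/= qu s1 s2].
    by apply: chain_arrow_ext => //; rewrite s2 -u1 -qu.
  + move=> /= <-; exists (mk_arrow (leqnn (sval q).2), q).
    by split; split.
- apply/funext => -[p []]; apply/funext => s; rewrite propeqE; split.
  + case=> -[_ u] /= [[/= <- u1]] [/= up s1 s2].
    by apply: chain_arrow_ext => //=; rewrite s1 u1 up.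
  + move=> /= <-; exists (p, mk_arrow (leqnn (sval p).1)).
    by split; split.
Qed.

Definition chain : rmonoid := RMonoid chain_monoid.

End Chain.

Section ChainMap.
Variables (m n : nat) (f : delta m n).

Definition chain_fun (p : chain m) : chain n := mk_arrow (delta_le f (svalP p)).

Lemma chain_fun1 p : rone (chain m) tt p -> rone (chain n) tt (chain_fun p).
Proof. by rewrite /= /chain_one /= => ->. Qed.

Lemma chain_funM p q r :
  rmul (chain m) (p, q) r ->
  rmul (chain n) (chain_fun p, chain_fun q) (chain_fun r).
Proof. by case=> /= e1 e2 e3; split=> /=; rewrite ?e1 ?e2 ?e3. Qed.

Definition chain_map : rmhom (chain m) (chain n) := RMHom chain_fun1 chain_funM.

End ChainMap.

Section MonoidNerve.
Variable M : rmonoid.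

Definition nerve_act m n (f : delta m n) (h : rmhom (chain n) M) :
    rmhom (chain m) M := rmhom_comp h (chain_map f).

Lemma nerve_act_id n (h : rmhom (chain n) M) : nerve_act (delta_id n) h = h.
Proof.
apply: rmhom_ext => p /=; congr (rmfun h _).
by apply: chain_arrow_ext; rewrite /= delta_idE.
Qed.

Lemma nerve_act_comp l m n (g : delta m n) (f : delta l m)
    (h : rmhom (chain n) M) :
  nerve_act (delta_comp g f) h = nerve_act f (nerve_act g h).
Proof.
apply: rmhom_ext => p /=; congr (rmfun h _).
by apply: chain_arrow_ext; rewrite /= delta_compE.
Qed.

Definition nerve_sset : sset := SSet nerve_act_id nerve_act_comp.

(* The identification of N(F)_1 with F: a homomorphism [1] -> F is determined
   by the image of (0,1), which is arbitrary. *)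
Definition arrow01 : chain 1 := @mk_arrow 1 ord0 ord_max isT.
Definition edge_val (h : nerve_sset 1) : M := h arrow01.

Lemma rmul1l (u a b : M) : rone M tt u -> rmul M (u, a) b -> a = b.
Proof.
move=> u1 uab; have := monoid1l (rmonoidP M).
move=> /(congr1 (fun R : hrel (unit * M) M => R (tt, a) b)).
by rewrite /lunit /graph /= => <-; exists (u, a).
Qed.

Lemma rmul1r (u a b : M) : rone M tt u -> rmul M (a, u) b -> a = b.
Proof.
move=> u1 aub; have := monoid1r (rmonoidP M).
move=> /(congr1 (fun R : hrel (M * unit) M => R (a, tt) b)).
by rewrite /runit /graph /= => <-; exists (a, u).
Qed.

Lemma rmul1l_ex (a : M) : exists u, rone M tt u /\ rmul M (u, a) a.
Proof.
have /(congr1 (fun R : hrel (unit * M) M => R (tt, a) a)) :=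
  monoid1l (rmonoidP M).
rewrite /lunit /graph /= propeqE => -[_ /(_ erefl)] [[u b]] [[/= u1 <-] uaa].
by exists u.
Qed.

Lemma rmul1r_ex (a : M) : exists u, rone M tt u /\ rmul M (a, u) a.
Proof.
have /(congr1 (fun R : hrel (M * unit) M => R (a, tt) a)) :=
  monoid1r (rmonoidP M).
rewrite /runit /graph /= propeqE => -[_ /(_ erefl)] [[b u]] [[/= <- u1] aua].
by exists u.
Qed.

Lemma rmulA (a b c d : M) :
  (exists x, rmul M (a, b) x /\ rmul M (x, c) d) <->
  (exists y, rmul M (b, c) y /\ rmul M (a, y) d).
Proof.
have /(congr1 (fun R : hrel (M * M * M) M => R (a, b, c) d)) :=
  monoidA (rmonoidP M).
rewrite propeqE => -[H1 H2]; split.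
- case=> x [abx xcd]; case: H1; first by exists (x, c).
  by move=> _ [<- [[a' y] [[/= <- bcy] ayd]]]; exists y.
- case=> y [bcy ayd]; case: H2.
    by exists (a, (b, c)); split=> //; exists (a, y).
  by case=> x c' [[/= abx <-] xcd]; exists x.
Qed.

Lemma roneM (u : M) : rone M tt u -> rmul M (u, u) u.
Proof.
by move=> u1; have [v [_ vuu]] := rmul1l_ex u; move: (vuu); rewrite (rmul1r u1 vuu).
Qed.

Lemma rone_src (a u v : M) : rone M tt u -> rone M tt v ->
  rmul M (a, u) a -> rmul M (a, v) a -> u = v.
Proof.
move=> u1 v1 au av.
have [|x [uvx _]] := (rmulA a u v a).1; first by exists a.
by rewrite (rmul1r v1 uvx) (rmul1l u1 uvx).
Qed.

Lemma rone_tgt (a u v : M) : rone M tt u -> rone M tt v ->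
  rmul M (u, a) a -> rmul M (v, a) a -> u = v.
Proof.
move=> u1 v1 ua va.
have [|x [uvx _]] := (rmulA u v a a).2; first by exists a.
by rewrite (rmul1r v1 uvx) (rmul1l u1 uvx).
Qed.

Lemma chain1_ind (P : chain 1 -> Prop) :
  P (@mk_arrow 1 ord0 ord0 isT) -> P arrow01 ->
  P (@mk_arrow 1 ord_max ord_max isT) -> forall p, P p.
Proof.
move=> P0 P01 P1 [[[[|[|//]] i2] [[|[|//]] j2]] //= ij].
- by congr P: P0; apply: chain_arrow_ext; exact: val_inj.
- by congr P: P01; apply: chain_arrow_ext; exact: val_inj.
- by congr P: P1; apply: chain_arrow_ext; exact: val_inj.
Qed.

Lemma edge_val_inj (h k : nerve_sset 1) : edge_val h = edge_val k -> h = k.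
Proof.
move=> hk; apply: rmhom_ext; apply: chain1_ind => //.
- by apply: (@rone_src (edge_val h)); rewrite ?[in rmul _ (edge_val h, k _)]hk;
    try exact: rmhom1; [exact: rmhomM | rewrite hk; exact: rmhomM].
- by apply: (@rone_tgt (edge_val h));
    try exact: rmhom1; [exact: rmhomM | rewrite hk; exact: rmhomM].
Qed.

Lemma edge_val_surj (a : M) : exists h : nerve_sset 1, edge_val h = a.
Proof.
have [u [u1 au]] := rmul1r_ex a; have [v [v1 va]] := rmul1l_ex a.
pose f (p : chain 1) : M :=
  if (sval p).2 == ord0 then u else if (sval p).1 == ord0 then a else v.
have f1 p : rone (chain 1) tt p -> rone M tt (f p).
  by elim/chain1_ind: p.
have fM p q r : rmul (chain 1) (p, q) r -> rmul M (f p, f q) (f r).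
  elim/chain1_ind: p; elim/chain1_ind: q; elim/chain1_ind: r;
    case=> //= _ _ _; rewrite /f //=; exact: roneM.
by exists (RMHom f1 fM).
Qed.

Definition edge_of (a : M) : nerve_sset 1 := sval (cid (edge_val_surj a)).

Lemma edge_ofK a : edge_val (edge_of a) = a.
Proof. exact: svalP (cid (edge_val_surj a)). Qed.

Lemma edge_valK h : edge_of (edge_val h) = h.
Proof. by apply: edge_val_inj; rewrite edge_ofK. Qed.

End MonoidNerve.

Definition nerve (F : frobenius) : eset :=
  @ESet (nerve_sset F) {a : F | rcounit F a tt} (fun a => edge_of (sval a)).

(* Main.v *)
Require Import Defs.
From mathcomp Require Import all_boot.
From mathcomp Require Import boolp zify.

(* Both sides of the equivalence are compared with the following data: a monoid
   M in Rel with a subset eps such that every a has a unique b with (b a)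
   meeting eps, and every b a unique such a.  Bending wires shows that this is
   the same as a Frobenius algebra: c is comultiplied to (a, b) iff (c l) gives
   a, where l is the element paired with b.

   A homomorphism [n] -> M is a labelling of the edges i < j such that all
   triangles are products, so a horn in the nerve only fails to determine a
   simplex by missing edges or triangles in dimension at most 4; these are
   supplied by the pairing and by associativity.

   Conversely, for X with the extension properties, the 2-simplices are
   determined by their boundaries (cone off a degenerate sphere by a marked
   edge), the 1-simplices form a monoid whose associativity is (iii) applied to
   cones over the two triangulations of a square, the horns of dimension at
   most 2 make the marked edges a pairing, and (ii) identifies X with the
   nerve. *)

Set Implicit Arguments.
Unset Strict Implicit.
Unset Printing Implicit Defensive.

(** * Cofaces, codegeneracies and extension problems *)

Lemma coface_subproof n i (a b : 'I_n.+1) : a <= b ->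
  (inord (bump i a) : 'I_n.+2) <= (inord (bump i b) : 'I_n.+2).
Proof. by move=> ab; have bn := ltn_ord b; rewrite /bump !inordK; lia. Qed.

Definition coface n i : delta n n.+1 := mk_delta (@coface_subproof n i).

Lemma cofaceE n i (a : 'I_n.+1) : coface n i a = bump i a :> nat.
Proof. by rewrite mk_deltaE inordK //; have := ltn_ord a; rewrite /bump; lia. Qed.

Lemma codeg_subproof n i (a b : 'I_n.+2) : a <= b ->
  (inord (minn n (unbump i a)) : 'I_n.+1) <= (inord (minn n (unbump i b)) : 'I_n.+1).
Proof. by move=> ab; rewrite /unbump !inordK; lia. Qed.

(** The cap at [n] matters only for [i > n], where it makes [codeg n i] equal to [codeg n n]. Thus
    every vertex [i <= n.+1], the last one included, has a codegeneracy retracting its coface. *)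
Definition codeg n i : delta n.+1 n := mk_delta (@codeg_subproof n i).

Lemma codegE n i (a : 'I_n.+2) : codeg n i a = minn n (unbump i a) :> nat.
Proof. by rewrite mk_deltaE inordK //; lia. Qed.

Lemma codeg_avoid n i (a : 'I_n.+2) : i <= n.+1 -> a != i :> nat ->
  codeg n i a = unbump i a :> nat.
Proof.
move=> i_n ai; rewrite codegE; apply/minn_idPr; have an := ltn_ord a.
by rewrite /unbump; case: (ltngtP i a) ai => // ia _; lia.
Qed.

Lemma unbump_neq i j x : i <= j -> x != i -> x != j.+1 -> unbump i x != j.
Proof. by rewrite /unbump; case: (ltngtP i x) => // ix ij _ xj; lia. Qed.

Lemma unbump_neq_lt i j x : i <= j -> x != i -> x != j.+1 -> unbump j.+1 x != i.
Proof. by rewrite /unbump; case: (ltngtP j.+1 x) => // jx ij xi _; lia. Qed.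

Lemma unbump_comm i j x : i <= j -> x != i -> x != j.+1 ->
  unbump j (unbump i x) = unbump i (unbump j.+1 x).
Proof.
move=> ij xi xj; rewrite /unbump.
case: (ltngtP i x) xi => // ix _; case: (ltngtP j.+1 x) xj => // jx _.
- by rewrite !subn1; case: ltnP; case: ltnP; lia.
- by rewrite subn0 subn1; case: ltnP; case: ltnP; lia.
- by lia.
- by rewrite !subn0; case: ltnP; case: ltnP; lia.
Qed.

Section Operators.
Variable X : sset.

Definition d n i (x : X n.+1) : X n := act (coface n i) x.
Definition s n i (x : X n) : X n.+1 := act (codeg n i) x.

Lemma act_eq m n (f g : delta m n) (x : X n) :
  (forall a, f a = g a :> nat) -> act f x = act g x.
Proof. by move=> fg; have -> : f = g by apply: delta_ext => a; apply/val_inj/fg. Qed.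

Lemma act_idP n (f : delta n n) (x : X n) :
  (forall a, f a = a :> nat) -> act f x = x.
Proof.
by move=> fa; rewrite -[RHS]act_id; apply: act_eq => a; rewrite delta_idE.
Qed.

Lemma dd n i j (x : X n.+2) : i <= j -> d i (d j.+1 x) = d j (d i x).
Proof.
move=> ij; rewrite /d -!act_comp; apply: act_eq => a.
by rewrite !delta_compE !cofaceE /bump; lia.
Qed.

Lemma ds n i (x : X n) : i <= n -> d i (s i x) = x.
Proof.
move=> i_n; rewrite /d /s -!act_comp; apply: act_idP => a.
by have := ltn_ord a; rewrite !delta_compE codegE cofaceE /bump /unbump; lia.
Qed.

Lemma dSs n i (x : X n) : i <= n -> d i.+1 (s i x) = x.
Proof.
move=> i_n; rewrite /d /s -!act_comp; apply: act_idP => a.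
by have := ltn_ord a; rewrite !delta_compE codegE cofaceE /bump /unbump; lia.
Qed.

Lemma ds_lt n i j (x : X n.+1) : i <= j -> j <= n -> d i (s j.+1 x) = s j (d i x).
Proof.
move=> ij jn; rewrite /d /s -!act_comp; apply: act_eq => a.
have := ltn_ord a; rewrite !delta_compE cofaceE !codegE cofaceE /bump /unbump; lia.
Qed.

Lemma ds_gt n i j (x : X n.+1) : j < i -> i <= n.+1 -> d i.+1 (s j x) = s j (d i x).
Proof.
move=> ij i_n; rewrite /d /s -!act_comp; apply: act_eq => a.
have := ltn_ord a; rewrite !delta_compE cofaceE !codegE cofaceE /bump /unbump; lia.
Qed.

(** [codeg n i] followed by [coface n i] moves no vertex other than [i], so an operator missing [i]
    sees only the face [d i x]. *)
Lemma act_sd m n i (f : delta m n.+1) (x : X n.+1) :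
  i <= n.+1 -> (forall a, f a != i :> nat) -> act f (s i (d i x)) = act f x.
Proof.
move=> i_n fi; rewrite /d /s -!act_comp; apply: act_eq => a.
have := ltn_ord (f a); move: (fi a).
rewrite !delta_compE cofaceE codegE /bump /unbump; lia.
Qed.

Definition compat n (P : pred nat) (y : nat -> X n.+1) :=
  forall i j, i <= j -> j <= n.+1 -> P i -> P j.+1 -> d i (y j.+1) = d j (y i).

(* A map missing the vertex [i] factors through the coface [i]; evaluating
   [s i (y i)] on it amounts to evaluating [y i] on the other factor. *)
Lemma compat_glue n (P : pred nat) (y : nat -> X n.+1) m (f : delta m n.+2) i j :
  compat P y -> i <= n.+2 -> j <= n.+2 -> P i -> P j ->
  (forall a, f a != i :> nat) -> (forall a, f a != j :> nat) ->
  act f (s i (y i)) = act f (s j (y j)).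
Proof.
move=> cy; wlog ij : i j / i < j => [IH|].
  case: (ltngtP i j) => [|ji in_ jn Pi Pj fi fj|-> //]; first exact: IH.
  by apply/esym/IH.
case: j ij => // j ij i_n jn Pi Pj fi fj.
(* Deleting [i] renames the vertex [j.+1] to [j], so what is left of [f] misses [j] and sees only
   [d j (y i)]. Symmetrically the other side sees only [d i (y j.+1)], and [cy] equates the two. *)
have -> : act f (s i (y i)) = act (delta_comp (codeg _ i) f) (s j (d j (y i))).
  rewrite act_sd ?act_comp // => a.
  by rewrite delta_compE codeg_avoid // unbump_neq.
have -> : act f (s j.+1 (y j.+1)) =
          act (delta_comp (codeg _ j.+1) f) (s i (d i (y j.+1))).
  rewrite act_sd ?act_comp //; first exact: (@leq_trans j).
  by move=> a; rewrite delta_compE codeg_avoid // unbump_neq_lt.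
rewrite cy // /s /d -!act_comp; apply: act_eq => a.
rewrite !delta_compE !cofaceE; congr bump.
rewrite [LHS]codegE [RHS]codegE !codeg_avoid //; congr minn.
exact: unbump_comm.
Qed.

Definition fills n (P : pred nat) (y : nat -> X n.+1) (x : X n.+2) :=
  forall i, i <= n.+2 -> P i -> d i x = y i.

Lemma fillsE n (P : pred nat) (y : nat -> X n.+1) x m (f : delta m n.+2) i :
  fills P y x -> i <= n.+2 -> P i -> (forall a, f a != i :> nat) ->
  act f x = act f (s i (y i)).
Proof. by move=> yx i_n Pi fi; rewrite -(yx i) // act_sd. Qed.

End Operators.

Lemma missesP m n (i : 'I_n.+1) (f : delta m n) :
  reflect (forall a, f a != i :> nat) (misses i f).
Proof. exact: forallP. Qed.

Lemma act_delta_id m n (f : delta m n) : act f (delta_id n : std_sset n n) = f.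
Proof. by apply: delta_ext => a; rewrite [LHS]delta_compE delta_idE. Qed.

(** * Extension along a union of faces as a filling problem *)

Section Extension.
Variables (X : eset) (n : nat) (T : Type) (l : T -> delta 1 n.+2).
Let D := @ESet (std_sset n.+2) T l.
Variables (P : pred nat) (S : subeset D).
Hypothesis SP : forall m (f : delta m n.+2),
  in_simp S f = [exists j : 'I_n.+3, P j && misses j f].
Hypothesis S_mark : forall t, in_mark S t.

(** The data of a morphism out of the union of the faces in [P]; values of [y] outside [P] are junk.
    The images [e] of the marks are tested on every face containing the marked edge. Taking [unit]
    or [void] for [T] treats marked and unmarked simplices at once. *)
Definition horn_data (y : nat -> X n.+1) :=
  compat P y /\
  exists e : T -> marks X, forall t i, i <= n.+2 -> P i ->
    (forall a, l t a != i :> nat) -> act (l t) (s i (y i)) = mark_edge (e t).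

Lemma inSP m (f : delta m n.+2) :
  in_simp S f -> exists i, [/\ i <= n.+2, P i & forall a, f a != i :> nat].
Proof.
by rewrite SP => /existsP[i /andP[Pi /missesP fi]]; exists i; split; rewrite // -ltnS.
Qed.

Lemma coface_in i : i <= n.+2 -> P i -> in_simp S (coface n.+1 i).
Proof.
move=> i_n Pi; rewrite SP; apply/existsP; exists (inord i).
by rewrite inordK // Pi; apply/missesP => a; rewrite cofaceE inordK // /bump; lia.
Qed.


Definition sub_elt m (f : delta m n.+2) (h : in_simp S f) : sub_eset S m :=
  @exist (delta m n.+2) (fun f => is_true (in_simp S f)) f h.

Lemma sub_elt_ext m (f g : sub_eset S m) :
  (forall a, sval f a = sval g a :> nat) -> f = g.
Proof.
case: f g => [f fS] [g gS] /= fg.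
have {}fg : f = g by apply: delta_ext => a; apply/val_inj/fg.
by subst g; rewrite (bool_irrelevance fS gS).
Qed.

Lemma sub_actE m k (g : delta m k) (f : sub_eset S k) :
  sval (act g f) = delta_comp (sval f) g.
Proof. by []. Qed.

Definition represents (phi : emor (sub_eset S) X) (y : nat -> X n.+1) :=
  forall m (f : sub_simplices S m) i, i <= n.+2 -> P i ->
    (forall a, sval f a != i :> nat) ->
    emor_simp phi f = act (sval f) (s i (y i)).

(** Each simplex is evaluated through some face containing it; by [compat_glue] the choice is
    immaterial, which gives naturality. *)
Lemma horn_data_hom y : horn_data y -> exists phi, represents phi y.
Proof.
case=> cy [e ye].
pose idx m (f : sub_simplices S m) := sval (cid (inSP (svalP f))).
have idxP m f : [/\ idx m f <= n.+2, P (idx m f) &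
    forall a, sval f a != idx m f :> nat] by rewrite /idx; case: cid.
pose phi m (f : sub_eset S m) : X m := act (sval f) (s (idx m f) (y (idx m f))).
have phiE m (f : sub_eset S m) i : i <= n.+2 -> P i -> (forall a, sval f a != i :> nat) ->
    phi m f = act (sval f) (s i (y i)).
  by move=> i_n Pi fi; have [? ? ?] := idxP m f; exact: (compat_glue cy).
have phi_act m k (g : delta m k) (f : sub_eset S k) : phi m (act g f) = act g (phi k f).
  have [i_n Pi fi] := idxP k f; rewrite (phiE _ _ (idx k f)) //.
    by rewrite /= act_comp.
  by move=> a; rewrite /= delta_compE.
have phi_edge (t : marks (sub_eset S)) : phi 1 (mark_edge t) = mark_edge (e (sval t)).
  by have [i_n Pi fi] := idxP 1 (mark_edge t); exact: (ye (sval t) _ i_n Pi fi).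
by exists (@EMor (sub_eset S) X phi (fun t => e (sval t)) phi_act phi_edge).
Qed.

Lemma hom_horn_data p0 phi : p0 <= n.+2 -> P p0 ->
  exists y, horn_data y /\ represents phi y.
Proof.
move=> p0_n Pp0.
have /choice[y yE] i : exists yi : X n.+1,
    forall h : in_simp S (coface n.+1 i), yi = emor_simp phi (sub_elt h).
  have [h|nh] := pselect (is_true (in_simp S (coface n.+1 i))).
    (* A default value for a face outside [S], supplied by the face [p0]. *)
    exists (emor_simp phi (sub_elt h)) => h'.
    by rewrite (bool_irrelevance h h').
  exists (emor_simp phi (sub_elt (coface_in p0_n Pp0))) => h.
  by [].
have phi_y : represents phi y.
  move=> m f i i_n Pi fi; rewrite (yE _ (coface_in i_n Pi)) /s -emor_act -emor_act.
  congr emor_simp; apply: sub_elt_ext => a;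
  rewrite !sub_actE !delta_compE cofaceE codegE /bump /unbump.
  by have := fi a; have := ltn_ord (sval f a); lia.
exists y; split=> //; split.
  move=> i j ij jn Pi Pj.
  rewrite (yE _ (@coface_in j.+1 jn Pj)).
  have i_n : i <= n.+2 by lia.
  rewrite (yE _ (coface_in i_n Pi)).
  rewrite /d -!emor_act; congr emor_simp; apply: sub_elt_ext => a.
  by rewrite !sub_actE !delta_compE !cofaceE /bump; lia.
exists (fun t => emor_mark phi (exist _ t (S_mark t))) => t i i_n Pi ti.
by rewrite -emor_edge (phi_y _ _ i).
Qed.

Lemma comp_incl_fills phi y (g : emor D X) : represents phi y ->
  emor_comp g (sub_incl S) = phi -> fills P y (emor_simp g (delta_id n.+2 : D n.+2)).
Proof.
move=> phi_y gphi i i_n Pi.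
have fi a : coface n.+1 i a != i :> nat by rewrite cofaceE /bump; lia.
have <- : act (coface n.+1 i) (s i (y i)) = y i.
  rewrite /s -act_comp act_idP // => a; have := ltn_ord a.
  by rewrite delta_compE codegE cofaceE /bump /unbump; lia.
rewrite -(phi_y _ (sub_elt (coface_in i_n Pi)) i) // -gphi /= /d -emor_act.
by congr emor_simp; exact: act_delta_id.
Qed.

(** By Yoneda [x] is a morphism on the whole simplex; its marks are those prescribed by [phi], as
    [S] contains every mark. *)
Lemma fills_hom phi y x : represents phi y -> fills P y x ->
  exists g : emor D X, emor_simp g (delta_id n.+2 : D n.+2) = x /\
    emor_comp g (sub_incl S) = phi.
Proof.
move=> phi_y yx.
pose g m (f : D m) : X m := act f x.
pose e (t : marks D) := emor_mark phi (exist _ t (S_mark t)).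
have g_phi m (f : sub_eset S m) : g m (sval f) = emor_simp phi f.
  have [i [i_n Pi fi]] := inSP (svalP f).
  by rewrite (phi_y _ _ i) // /g (fillsE yx i_n).
have g_act m k (h : delta m k) (f : D k) : g m (act h f) = act h (g k f).
  by rewrite /g /= act_comp.
have g_edge (t : marks D) : g 1 (mark_edge t) = mark_edge (e t).
  rewrite /e -emor_edge -g_phi //.
exists (EMor g_act g_edge); split; first by rewrite /= /g act_id.
apply: emor_ext => [m f|[t tS]] /=; first exact: g_phi.
by rewrite /e; congr emor_mark; exact: eq_exist.
Qed.

Lemma hom_inj (phi : emor (sub_eset S) X) (g h : emor D X) :
  emor_comp g (sub_incl S) = phi -> emor_comp h (sub_incl S) = phi ->
  emor_simp g (delta_id n.+2 : D n.+2) = emor_simp h (delta_id n.+2 : D n.+2) ->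
  g = h.
Proof.
move=> gphi hphi gh; apply: emor_ext => [m f|t].
  have <- : act f (delta_id n.+2 : D n.+2) = f by exact: act_delta_id.
  by rewrite !emor_act gh.
have := congr1 (fun k : emor (sub_eset S) X => emor_mark k (exist _ t (S_mark t))) gphi.
by rewrite -hphi.
Qed.

Hypothesis P_ex : exists2 p, p <= n.+2 & P p.

Lemma extensionP : extension_property X (sub_incl S) <->
  forall y, horn_data y -> exists x, fills P y x.
Proof.
have [p0 p0_n Pp0] := P_ex; split=> [ext y /horn_data_hom[phi phi_y]|fill phi].
  by have [g /(comp_incl_fills phi_y)] := ext phi; eexists; eassumption.
have [y [/fill[x yx] phi_y]] := hom_horn_data phi p0_n Pp0.
by have [g [_ gphi]] := fills_hom phi_y yx; exists g.
Qed.

Lemma unique_extensionP : unique_extension_property X (sub_incl S) <->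
  forall y, horn_data y -> exists! x, fills P y x.
Proof.
have [p0 p0_n Pp0] := P_ex; split=> [ext y /horn_data_hom[phi phi_y]|fill phi].
  have [g [gphi g_uniq]] := ext phi.
  exists (emor_simp g (delta_id n.+2 : D n.+2)); split; first exact: comp_incl_fills gphi.
  by move=> x /(fills_hom phi_y)[h [<- /g_uniq->]].
have [y [/fill[x [yx x_uniq]] phi_y]] := hom_horn_data phi p0_n Pp0.
have [g [gx gphi]] := fills_hom phi_y yx; exists g; split=> // h hphi.
apply: (hom_inj gphi hphi); rewrite gx; apply: x_uniq.
exact: (comp_incl_fills phi_y hphi).
Qed.

End Extension.

Lemma long_edgeE n a : long_edge n a = (if a == ord0 then 0 else n) :> nat.
Proof. by rewrite mk_deltaE; case: eqP. Qed.

Lemma ord2P (a : 'I_2) : a = ord0 \/ a = ord_max.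
Proof. by case: a => [[|[|//]] lt_a]; [left|right]; exact: val_inj. Qed.

Lemma long_edge_avoid n i : (forall a, long_edge n a != i :> nat) <-> 0 < i /\ i != n.
Proof.
split=> [avoid|[i0 i_n] a]; last by rewrite long_edgeE; case: ifP => _; lia.
by move: (avoid ord0) (avoid ord_max); rewrite !long_edgeE /=; lia.
Qed.

Lemma in_ehorn n (i : 'I_n.+1) m (f : delta m n) :
  in_simp (ehorn i) f = [exists j : 'I_n.+1, (j != i :> nat) && misses j f].
Proof. by []. Qed.

(** From dimension 2 on, the vertex 1 is not on the long edge, so the face opposite 1 contains the
    mark. In dimension 1 the horn has no mark, and that case is treated separately. *)
Lemma in_ehorn_mark n (i : 'I_n.+3) t : i != 1 :> nat -> in_mark (ehorn i) t.
Proof.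
move=> i1; apply/existsP; exists (inord 1).
have v1 : (inord 1 : 'I_n.+3) = 1 :> nat by rewrite inordK.
have -> /= : (inord 1 : 'I_n.+3) != i by rewrite -(inj_eq val_inj) /= v1 eq_sym.
by apply/missesP/long_edge_avoid; rewrite v1.
Qed.

Lemma act_long_edge_s (X : sset) n i (x : X n.+1) : 0 < i -> i < n.+2 ->
  act (long_edge n.+2) (s i x) = act (long_edge n.+1) x.
Proof.
move=> i0 i_n; rewrite /s -act_comp; apply: act_eq => a.
by rewrite delta_compE codegE !long_edgeE /unbump; case: eqP => _; lia.
Qed.

Section HornData.
Variables (X : eset) (n : nat).

(** The faces opposite inner vertices are exactly those containing the long edge, which is also the
    long edge of each of them. *)
Lemma marked_horn_data (P : pred nat) (y : nat -> X n.+1) :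
  horn_data (fun _ : unit => long_edge n.+2) P y <->
  compat P y /\ exists e, forall i, 0 < i < n.+2 -> P i ->
    act (long_edge n.+1) (y i) = mark_edge e.
Proof.
split=> -[cy [e ye]]; split=> //.
  exists (e tt) => i /andP[i0 i_n] Pi; rewrite -(@act_long_edge_s _ _ i) //.
  by apply: ye => //; [exact: ltnW|apply/long_edge_avoid; lia].
exists (fun=> e) => _ i i_n Pi /long_edge_avoid[i0 i_n2].
by rewrite act_long_edge_s ?ye //; lia.
Qed.

Lemma unmarked_horn_data (P : pred nat) (y : nat -> X n.+1) :
  horn_data (fun t : void => match t with end) P y <-> compat P y.
Proof. by split=> [[]|cy] //; split=> //; exists (fun t : void => match t with end) => -[]. Qed.

Lemma ehornP (i : 'I_n.+3) : i != 1 :> nat ->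
  unique_extension_property X (sub_incl (ehorn i)) <->
  forall y : nat -> X n.+1, compat (fun j => j != i) y ->
    (exists e, forall j, 0 < j < n.+2 -> j != i ->
      act (long_edge n.+1) (y j) = mark_edge e) ->
  exists! x : X n.+2, fills (fun j => j != i) y x.
Proof.
move=> i1; rewrite (@unique_extensionP X n unit _ (fun j => j != i) _
  (@in_ehorn _ i)); first last.
- by exists 1; rewrite // eq_sym.
- by move=> t; exact: in_ehorn_mark.
by split=> H y => [cy ye|/marked_horn_data[cy ye]]; apply: H;
  [exact/marked_horn_data | exact: cy | exact: ye].
Qed.

Lemma boundaryP :
  unique_extension_property X (sub_incl (boundary n.+2)) <->
  forall y : nat -> X n.+1, compat predT y ->
  exists! x : X n.+2, fills predT y x.
Proof.
rewrite (@unique_extensionP X n void _ predT (boundary n.+2)) //; last by exists 0.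
by split=> H y => [cy|/unmarked_horn_data cy]; apply: H => //;
  apply/unmarked_horn_data.
Qed.

End HornData.

Lemma two_facesP (X : eset) :
  extension_property X
    (sub_incl (sub_cup (@eface 4 (inord 1)) (@eface 4 (inord 3)))) <->
  forall (y1 y3 : X 3), d 1 y3 = d 2 y1 ->
    (exists e, d 1 (d 1 y1) = mark_edge e) ->
  exists x : X 4, d 1 x = y1 /\ d 3 x = y3.
Proof.
pose P j := (j == 1) || (j == 3).
have SP m (f : delta m 4) :
    in_simp (sub_cup (@eface 4 (inord 1)) (@eface 4 (inord 3))) f =
    [exists j : 'I_5, P j && misses j f].
  apply/orP/existsP => [[]h|[j]]; first by exists (inord 1); rewrite /P inordK.
    by exists (inord 3); rewrite /P !inordK.
  by case/andP=> /orP[] /eqP j_eq h; [left|right]; rewrite -[X in inord X]j_eq inord_val.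
rewrite (@extensionP X 2 unit _ P _ SP); first last.
- by exists 1.
- move=> t; apply/orP; left; apply/missesP/long_edge_avoid.
  by rewrite inordK.
have long3 x : act (long_edge 3) x = d 1 (d 1 x) :> X 1.
  rewrite /d -!act_comp; apply: act_eq => a.
  by rewrite !delta_compE !cofaceE long_edgeE; case: (ord2P a) => -> /=.
split=> H.
  move=> y1 y3 y13 [e y1e].
  have [|x xy] := H (fun j => if j == 1 then y1 else y3).
    apply/marked_horn_data; split.
      by move=> i j ij j3 /orP[]/eqP i1 /orP[]/eqP[j1]; subst i j.
    exists e => i _ /orP[]/eqP-> //=; rewrite long3 ?y1e //.
    (* The long edge of [y3] lies in the common face of [y1] and [y3], so it is marked because that
       of [y1] is. *)
    by rewrite y13 dd.
  by exists x; split; [exact: (xy 1)|exact: (xy 3)].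
move=> y /marked_horn_data[cy [e ye]].
have [||x [x1 x3]] := H (y 1) (y 3); first exact: (cy 1 2).
  by exists e; rewrite -long3 ye.
by exists x => i _ /orP[]/eqP->.
Qed.

Definition collapse m : delta m 0 :=
  mk_delta (fun (i j : 'I_m.+1) (_ : i <= j) => leqnn (@ord0 0)).

(** * Horns of dimension one *)

Section DimensionOne.
Variables (X : eset) (i : 'I_2).
Let D := std_esimplex 1.
Let S : subeset D := ehorn i.
(** The vertex [i] itself, described as the face opposite the other vertex. *)
Let c : D 0 := coface 0 (1 - i).

Lemma long_edge1 : long_edge 1 = delta_id 1.
Proof.
apply: delta_ext => a; apply: val_inj; rewrite /= delta_idE long_edgeE.
by case: (ord2P a) => ->.
Qed.

Lemma ehorn1_simplex m (f : D m) : in_simp S f -> f = delta_comp c (collapse m).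
Proof.
move=> /existsP[j /andP[ji /missesP fj]]; apply: delta_ext => a; apply: ord_inj.
rewrite delta_compE /c cofaceE mk_deltaE /bump.
move: (fj a) ji (ltn_ord i) (ltn_ord j) (ltn_ord (f a)).
by rewrite -(inj_eq val_inj) /=; lia.
Qed.

Lemma ehorn1_mark t : ~ in_mark S t.
Proof.
by move=> /existsP[j /andP[_ /missesP/long_edge_avoid]]; have := ltn_ord j; lia.
Qed.

Lemma ehorn1_vertex : in_simp S c.
Proof.
apply/existsP; exists (inord (1 - i)); rewrite -(inj_eq val_inj) /= inordK; last lia.
apply/andP; split; first by have := ltn_ord i; lia.
by apply/missesP => a; rewrite cofaceE inordK /bump; lia.
Qed.

Definition ehorn1_elt : sub_eset S 0 :=
  @exist (D 0) (fun f => is_true (in_simp S f)) c ehorn1_vertex.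

Lemma ehorn1_hom (v : X 0) :
  exists phi : emor (sub_eset S) X, emor_simp phi ehorn1_elt = v.
Proof.
pose phi m (f : sub_eset S m) : X m := act (collapse m) v.
pose e (t : marks (sub_eset S)) : marks X := False_rect _ (ehorn1_mark (svalP t)).
have phi_act m k (g : delta m k) (f : sub_eset S k) :
    phi m (act g f) = act g (phi k f).
  rewrite /phi -act_comp; apply: act_eq => a.
  by rewrite delta_compE !mk_deltaE.
have phi_edge t : phi 1 (mark_edge t) = mark_edge (e t).
  by case: (ehorn1_mark (svalP t)).
exists (EMor phi_act phi_edge); rewrite /= /phi act_idP // => a.
by rewrite mk_deltaE ord1.
Qed.

Lemma esimplex1_hom (e : marks X) : exists g : emor D X, emor_mark g tt = e.
Proof.
pose g m (f : D m) : X m := act f (mark_edge e).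
have g_act m k (h : delta m k) (f : D k) : g m (act h f) = act h (g k f).
  by rewrite /g /= act_comp.
have g_edge (t : marks D) : g 1 (mark_edge t) = mark_edge e.
  by rewrite /g /= long_edge1 act_id.
by exists (@EMor D X g (fun=> e) g_act g_edge).
Qed.

(** Every simplex of the marked interval is an image of its marked edge under an operator, so a
    morphism out of it amounts to a mark. *)
Lemma esimplex1_simpE (g : emor D X) m (f : D m) :
  emor_simp g f = act f (mark_edge (emor_mark g tt)).
Proof.
rewrite -emor_edge -emor_act; congr emor_simp; apply/esym.
have -> : @mark_edge D tt = delta_id 1 by exact: long_edge1.
exact: act_delta_id.
Qed.

Lemma esimplex1_hom_inj (g h : emor D X) : emor_mark g tt = emor_mark h tt -> g = h.
Proof.
by move=> gh; apply: emor_ext => [m f|[]//]; rewrite !esimplex1_simpE gh.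
Qed.

Lemma ehorn1_comp (phi : emor (sub_eset S) X) (g : emor D X) :
  emor_comp g (sub_incl S) = phi <->
  d (1 - i) (mark_edge (emor_mark g tt)) = emor_simp phi ehorn1_elt.
Proof.
split=> [<-|gphi]; first by rewrite /= esimplex1_simpE.
apply: emor_ext => [m [f fS]|[t tS]]; last by case: (ehorn1_mark tS).
have fE := ehorn1_simplex fS.
have -> : exist _ f fS = act (collapse m) ehorn1_elt.
  by apply: val_inj.
rewrite [LHS]emor_act [RHS]emor_act -gphi; congr act.
exact: (esimplex1_simpE g c).
Qed.

Lemma ehorn1P :
  unique_extension_property X (sub_incl S) <->
  forall v : X 0, exists! e, d (1 - i) (mark_edge e) = v.
Proof.
split=> [ext v|ext phi].
  have [phi phi_v] := ehorn1_hom v.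
  have [g [/ehorn1_comp gphi g_uniq]] := ext phi.
  exists (emor_mark g tt); split=> [|e ev]; first by rewrite gphi.
  have [h he] := esimplex1_hom e.
  by rewrite (g_uniq h) //; apply/ehorn1_comp; rewrite he ev phi_v.
have [e [ev e_uniq]] := ext (emor_simp phi ehorn1_elt).
have [g ge] := esimplex1_hom e.
exists g; split=> [|h /ehorn1_comp hphi]; first by apply/ehorn1_comp; rewrite ge.
by apply: esimplex1_hom_inj; rewrite ge; exact: e_uniq.
Qed.

End DimensionOne.

(** * Frobenius algebras as monoids with a pairing *)

Section Form.
Variables (M : rmonoid) (eps : M -> Prop).
Local Notation mul a b c := (rmul M (a, b) c).

Definition pairing (b a : M) := exists e, eps e /\ mul b a e.

Definition nondegenerate :=
  (forall a, exists! b, pairing b a) /\ (forall b, exists! a, pairing b a).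

Definition form_comul : hrel M (M * M) :=
  fun c ab => exists l, mul c l ab.1 /\ pairing ab.2 l.
Definition form_counit : hrel M unit := fun a _ => eps a.

Hypothesis nd : nondegenerate.

Lemma pairing_injl a b b' : pairing b a -> pairing b' a -> b = b'.
Proof. by have [b0 [_ b0u]] := nd.1 a => /b0u <- /b0u. Qed.

Lemma pairing_injr b a a' : pairing b a -> pairing b a' -> a = a'.
Proof. by have [a0 [_ a0u]] := nd.2 b => /a0u <- /a0u. Qed.

Lemma pairing_exl a : exists b, pairing b a.
Proof. by have [b [h _]] := nd.1 a; exists b. Qed.

Lemma pairing_exr b : exists a, pairing b a.
Proof. by have [a [h _]] := nd.2 b; exists a. Qed.

(** Since [r (c l)] meets [eps], so does [(r c) l]: the product of [r] and [c] is paired with [l],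
    hence is [b]. For consecutive edges [l], [c], [r] of a tetrahedron with long edge in [eps], this
    recovers the face opposite the first vertex from the other three; [unrotate] recovers the one
    opposite the last. *)
Lemma rotate c l a r b : mul c l a -> pairing r a -> pairing b l -> mul r c b.
Proof.
move=> cl [e [ee ra]] bl; have [|y [rc yl]] := (rmulA r c l e).2; first by exists a.
by rewrite (pairing_injl bl (b' := y)) //; exists e.
Qed.

Lemma unrotate c l a r b : mul r c b -> pairing r a -> pairing b l -> mul c l a.
Proof.
move=> rc ra [e [ee bl]]; have [|y [cl ry]] := (rmulA r c l e).1; first by exists b.
by rewrite (pairing_injr ra (a' := y)) //; exists e.
Qed.

(** Either output of the comultiplication can be bent into an input: [a] here, [b] in
    [form_comulE']. Bending outer outputs turns coassociativity and the Frobenius laws into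
    associativity. *)
Lemma form_comulE c a b r : pairing r a -> form_comul c (a, b) <-> mul r c b.
Proof.
move=> ra; split=> [[l [cl bl]]|rc]; first exact: rotate cl ra bl.
by have [l bl] := pairing_exr b; exists l; split=> //; exact: unrotate rc ra bl.
Qed.

Lemma form_comulE' c a b l : pairing b l -> form_comul c (a, b) <-> mul c l a.
Proof.
move=> bl; split=> [[l' [cl bl']]|cl]; last by exists l.
by rewrite (pairing_injr bl bl').
Qed.

(** The left identity of [e] is a partner of [e], as their product [e] is in [eps]; partners being
    unique, there is no other. This reduces the counit laws to the unit laws. *)
Lemma pairing_unitr e u : eps e -> pairing u e <-> rone M tt u /\ mul u e e.
Proof.
move=> ee; split=> [ue|[_ ue]]; last by exists e.
have [v [v1 ve]] := rmul1l_ex e.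
by rewrite (@pairing_injl e u v) //; exists e.
Qed.

Lemma pairing_unitl e u : eps e -> pairing e u <-> rone M tt u /\ mul e u e.
Proof.
move=> ee; split=> [eu|[_ eu]]; last by exists e.
have [v [v1 ev]] := rmul1r_ex e.
by rewrite (@pairing_injr e u v) //; exists e.
Qed.

(** With [p] and [b] bent into [r] and [l], the two sides of coassociativity say that [q] is a value
    of [r (c l)], respectively of [(r c) l]. *)
Lemma form_comonoid : is_comonoid form_comul form_counit.
Proof.
split.
- apply/funext => c; apply/funext => -[p [q b]]; rewrite propeqE.
  have [r rp] := pairing_exl p; have [l bl] := pairing_exr b.
  split.
    case=> -[a b''] [cab [[[p' q'] b'] [[/= apq bb] [? ? ?]]]].
    rewrite /rid in bb; subst p' q' b' b''; move: cab apq.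
    rewrite (form_comulE' _ _ bl) (form_comulE _ _ rp) => cl ra.
    have [|y [rc yl]] := (rmulA r c l q).2; first by exists a.
    exists (p, y); split; first exact/(form_comulE _ _ rp).
    by split=> //=; apply/(form_comulE' _ _ bl).
  case=> -[p' a] [cpa [/= pp]]; rewrite /rid in pp; subst p'.
  move: cpa; rewrite (form_comulE _ _ rp) (form_comulE' _ _ bl) => rc al.
  have [|y [cl ry]] := (rmulA r c l q).1; first by exists a.
  exists (y, b); split; first exact/(form_comulE' _ _ bl).
  by exists ((p, q), b); split=> //; split=> //=; apply/(form_comulE _ _ rp).
- apply/funext => c; apply/funext => -[[] b]; rewrite propeqE; split.
    case=> -[a b'] [cab [/= ea]]; rewrite /rid => bb; subst b'.
    have [u [u1 ua]] := rmul1l_ex a.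
    have /(pairing_unitr _ ea) upa : rone M tt u /\ mul u a a by [].
    by move: cab; rewrite (form_comulE _ _ upa) => /(rmul1l u1) ->.
  case=> <-; have [u [u1 uc]] := rmul1l_ex c; have [a [e [ee uae]]] := pairing_exr u.
  have ae := rmul1l u1 uae; subst e; exists (a, c); split; last by [].
  by apply/(form_comulE _ _ (r := u)) => //; exists a.
- apply/funext => c; apply/funext => -[a []]; rewrite propeqE; split.
    case=> -[a' b] [cab []]; rewrite /rid /= => aa eb; subst a'.
    have [u [u1 bu]] := rmul1r_ex b.
    have /(pairing_unitl _ eb) pbu : rone M tt u /\ mul b u b by [].
    by move: cab; rewrite (form_comulE' _ _ pbu) => /(rmul1r u1) ->.
  case=> <-; have [u [u1 cu]] := rmul1r_ex c; have [b [e [ee bue]]] := pairing_exl u.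
  have be := rmul1r u1 bue; subst e; exists (c, b); split; last by [].
  by apply/(form_comulE' _ _ (l := u)) => //; exists b.
Qed.

(** With [b] bent into [l], both sides say that [x], [c], [l] multiply to [p], with different
    bracketings. *)
Lemma form_frobenius_l :
  (rmul M \xR rid) \oR rassoc_inv \oR (rid \xR form_comul) = form_comul \oR rmul M.
Proof.
apply/funext => -[x c]; apply/funext => -[p b]; rewrite propeqE.
have [l bl] := pairing_exr b; split.
  case=> -[x' [a b']] [[/= xx cab]] [_ [<- [/= xap bb]]].
  rewrite /rid in xx bb; subst x' b'; move: cab; rewrite (form_comulE' _ _ bl) => cl.
  have [|y [xc yl]] := (rmulA x c l p).2; first by exists a.
  by exists y; split=> //; apply/(form_comulE' _ _ bl).
case=> y [xc]; rewrite (form_comulE' _ _ bl) => yl.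
have [|a [cl xa]] := (rmulA x c l p).1; first by exists y.
exists (x, (a, b)); split; first by split=> //=; apply/(form_comulE' _ _ bl).
by exists ((x, a), b).
Qed.

Lemma form_frobenius_r :
  (rid \xR rmul M) \oR rassoc \oR (form_comul \xR rid) = form_comul \oR rmul M.
Proof.
apply/funext => -[c x]; apply/funext => -[a q]; rewrite propeqE.
have [r ra] := pairing_exl a; split.
  case=> -[[a' b] x'] [[/= cab xx]] [_ [<- [/= aa bxq]]].
  rewrite /rid in xx aa; subst x' a'; move: cab; rewrite (form_comulE _ _ ra) => rc.
  have [|y [cx ry]] := (rmulA r c x q).1; first by exists b.
  by exists y; split=> //; apply/(form_comulE _ _ ra).
case=> y [cx]; rewrite (form_comulE _ _ ra) => ry.
have [|b [rc bx]] := (rmulA r c x q).2; first by exists y.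
exists ((a, b), x); split; first by split=> //=; apply/(form_comulE _ _ ra).
by exists (a, (b, x)).
Qed.

Definition form_frobenius : frobenius :=
  Frobenius form_comonoid form_frobenius_l form_frobenius_r.

End Form.

(** * The pairing of a Frobenius algebra *)

Section FrobeniusForm.
Variable F : frobenius.
Local Notation mul a b c := (rmul F (a, b) c).
Let P := @pairing F (fun a => rcounit F a tt).

(** The snake argument: the Frobenius law followed by the counit on the first output. *)
Lemma frobenius_bendl x c b :
  mul x c b <-> exists a, rcomul F c (a, b) /\ P x a.
Proof.
have counitE (c' b' : F) : c' = b' <-> exists e, rcomul F c' (e, b') /\ rcounit F e tt.
  have := congr1 (fun R : hrel F (unit * F) => R c' (tt, b')) (comonoid1l (rcomonoidP F)).
  rewrite propeqE /lunit_inv /graph => -[H1 H2]; split=> [cb|[e [ce ee]]].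
    have [|[e b0] [ce [/= ee bb]]] := H2; first by rewrite cb.
    by rewrite /rid in bb; subst b0; exists e.
  by have /(congr1 snd) : (tt, c') = (tt, b') by apply: H1; exists (e, b').
have /(congr1 (fun R : hrel (F * F) (F * F) => fun e => R (x, c) (e, b))) frob :=
  frobenius_l F.
split=> [xc|[a [cab [e [ee xa]]]]].
  have [e [be ee]] := (counitE b b).1 erefl.
  have : (rcomul F \oR rmul F) (x, c) (e, b) by exists b.
  rewrite -(congr1 (fun R => R e) frob) =>
    -[[x' [a b']] [[/= xx cab]] [_ [<- [/= xae bb]]]].
  by rewrite /rid in xx bb; subst x' b'; exists a; split=> //; exists e.
have : ((rmul F \xR rid) \oR rassoc_inv \oR (rid \xR rcomul F)) (x, c) (e, b).
  by exists (x, (a, b)); split=> //; exists ((x, a), b).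
rewrite (congr1 (fun R => R e) frob) => -[y [xcy ye]].
by have -> : b = y by apply/esym/counitE; exists e.
Qed.

Lemma frobenius_bendr x c a :
  mul c x a <-> exists b, rcomul F c (a, b) /\ P b x.
Proof.
have counitE (c' a' : F) : c' = a' <-> exists e, rcomul F c' (a', e) /\ rcounit F e tt.
  have := congr1 (fun R : hrel F (F * unit) => R c' (a', tt)) (comonoid1r (rcomonoidP F)).
  rewrite propeqE /runit_inv /graph => -[H1 H2]; split=> [cb|[e [ce ee]]].
    have [|[a0 e] [ce [/= aa ee]]] := H2; first by rewrite cb.
    by rewrite /rid in aa; subst a0; exists e.
  by have /(congr1 fst) : (c', tt) = (a', tt) by apply: H1; exists (a', e).
have /(congr1 (fun R : hrel (F * F) (F * F) => fun e => R (c, x) (a, e))) frob :=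
  frobenius_r F.
split=> [cx|[b [cab [e [ee bx]]]]].
  have [e [ae ee]] := (counitE a a).1 erefl.
  have : (rcomul F \oR rmul F) (c, x) (a, e) by exists a.
  rewrite -(congr1 (fun R => R e) frob) =>
    -[[[a' b] x'] [[/= cab xx]] [_ [<- [/= aa bxe]]]].
  by rewrite /rid in xx aa; subst x' a'; exists b; split=> //; exists e.
have : ((rid \xR rmul F) \oR rassoc \oR (rcomul F \xR rid)) (c, x) (a, e).
  by exists ((a, b), x); split=> //; exists (a, (b, x)).
rewrite (congr1 (fun R => R e) frob) => -[y [cxy ye]].
by have -> : a = y by apply/esym/counitE; exists e.
Qed.

(** Bending [u x = x], for [u] the left identity of [x], comultiplies [u] into [(x, b0)] with [b0]
    paired with [x]. Bending back with any partner [b] of [x] gives [b u = b0], so [b = b0]. The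
    other half is symmetric. *)
Lemma frobenius_nondegenerate : nondegenerate (fun a : F => rcounit F a tt).
Proof.
split=> x.
  have [u [u1 ux]] := rmul1l_ex x.
  have [b0 [uxb b0x]] := (frobenius_bendr x u x).1 ux.
  exists b0; split=> // b bx.
  have /(frobenius_bendl b u b0).2 : exists a, rcomul F u (a, b0) /\ P b a by exists x.
  by move/(rmul1r u1).
have [u [u1 xu]] := rmul1r_ex x.
have [a0 [uax xa0]] := (frobenius_bendl x u x).1 xu.
exists a0; split=> // a xa.
have /(frobenius_bendr a u a0).2 : exists b, rcomul F u (a0, b) /\ P b a by exists x.
by move/(rmul1l u1).
Qed.

End FrobeniusForm.

(** * Simplices of a nerve *)

Lemma edge_subproof n i j (a b : 'I_2) : a <= b ->
  (inord (if a == ord0 then minn i (minn j n) else minn j n) : 'I_n.+1) <=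
  (inord (if b == ord0 then minn i (minn j n) else minn j n) : 'I_n.+1).
Proof.
by case: (ord2P a) (ord2P b) => -> [] -> //= _; rewrite !inordK; lia.
Qed.

(* Meaningful for [i <= j <= n]; out of range indices are truncated. *)
Definition edge n i j : delta 1 n := mk_delta (@edge_subproof n i j).

Lemma edgeE n i j a : i <= j -> j <= n ->
  edge n i j a = (if a == ord0 then i else j) :> nat.
Proof. by move=> ij jn; rewrite mk_deltaE; case: ifP => _; rewrite inordK; lia. Qed.

Lemma edge_comp m n (f : delta m n) i j : i <= j -> j <= m ->
  delta_comp f (edge m i j) = edge n (f (inord i)) (f (inord j)).
Proof.
move=> ij jm; apply: delta_ext => a; apply: ord_inj.
have fij : f (inord i) <= f (inord j) by apply: delta_le; rewrite !inordK; lia.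
have fj := ltn_ord (f (inord j)).
rewrite delta_compE edgeE //; case: (ord2P a) => -> /=.
  by congr (nat_of_ord (f _)); apply: ord_inj; rewrite edgeE ?inordK //; lia.
by congr (nat_of_ord (f _)); apply: ord_inj; rewrite edgeE ?inordK //; lia.
Qed.

Lemma long_edge_edge n : long_edge n = edge n 0 n.
Proof. by apply: delta_ext => a; apply: ord_inj; rewrite edgeE // long_edgeE. Qed.

Definition edge_arrow n i j : chain n := chain_fun (edge n i j) arrow01.

Lemma edge_arrow1 n i j : i <= j -> j <= n -> (sval (edge_arrow n i j)).1 = i :> nat.
Proof. exact: edgeE ord0. Qed.

Lemma edge_arrow2 n i j : i <= j -> j <= n -> (sval (edge_arrow n i j)).2 = j :> nat.
Proof. exact: edgeE ord_max. Qed.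

(** * Sources and targets in a monoid *)

Section Endpoints.
Variable M : rmonoid.
Local Notation mul a b c := (rmul M (a, b) c).

(** In a product [a b] the factor [b] comes first, as for composition, so sources are right
    identities and targets left ones. They are unique by [rone_src] and [rone_tgt]. *)
Definition src (a : M) : M := sval (cid (rmul1r_ex a)).
Definition tgt (a : M) : M := sval (cid (rmul1l_ex a)).

Lemma rone_of_src a : rone M tt (src a). Proof. exact: (svalP (cid (rmul1r_ex a))).1. Qed.
Lemma rone_of_tgt a : rone M tt (tgt a). Proof. exact: (svalP (cid (rmul1l_ex a))).1. Qed.
Lemma mul_src a : mul a (src a) a. Proof. exact: (svalP (cid (rmul1r_ex a))).2. Qed.
Lemma mul_tgt a : mul (tgt a) a a. Proof. exact: (svalP (cid (rmul1l_ex a))).2. Qed.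

Lemma mul_srcr a b c u : mul a b c -> rone M tt u -> mul b u b -> mul c u c.
Proof.
move=> abc u1 bu; have [|x [abx xuc]] := (rmulA a b u c).2; first by exists b.
by move: (xuc); rewrite (rmul1r u1 xuc).
Qed.

Lemma mul_tgtl a b c u : mul a b c -> rone M tt u -> mul u a a -> mul u c c.
Proof.
move=> abc u1 ua; have [|x [abx uxc]] := (rmulA u a b c).1; first by exists a.
by move: (uxc); rewrite (rmul1l u1 uxc).
Qed.

Lemma mul_middle a b c u : mul a b c -> rone M tt u -> mul a u a -> mul u b b.
Proof.
move=> abc u1 au; have [|x [ubx axc]] := (rmulA a u b c).1; first by exists a.
by move: (ubx); rewrite -(rmul1l u1 ubx).
Qed.

Lemma src_mul a b c : mul a b c -> src c = src b.
Proof.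
move=> abc; apply: (rone_src (rone_of_src _) (rone_of_src _) (mul_src c)).
exact: mul_srcr abc (rone_of_src _) (mul_src b).
Qed.

Lemma tgt_mul a b c : mul a b c -> tgt c = tgt a.
Proof.
move=> abc; apply: (rone_tgt (rone_of_tgt _) (rone_of_tgt _) (mul_tgt c)).
exact: mul_tgtl abc (rone_of_tgt _) (mul_tgt a).
Qed.

Lemma src_tgt a b c : mul a b c -> src a = tgt b.
Proof.
move=> abc; apply: (rone_tgt (rone_of_src _) (rone_of_tgt _) _ (mul_tgt b)).
exact: mul_middle abc (rone_of_src _) (mul_src a).
Qed.

End Endpoints.

Section NerveEdges.
Variable M : rmonoid.
Local Notation mul a b c := (rmul M (a, b) c).
Local Notation N := (nerve_sset M).

Definition ev n (h : N n) i j : M := edge_val (act (edge n i j) h).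

Lemma evE n (h : N n) i j : ev h i j = h (edge_arrow n i j).
Proof. by []. Qed.

Lemma ev_act m n (f : delta m n) (h : N n) i j : i <= j -> j <= m ->
  ev (act f h) i j = ev h (f (inord i)) (f (inord j)).
Proof. by move=> ij jm; rewrite /ev -act_comp edge_comp. Qed.

Lemma ev_one n (h : N n) i : i <= n -> rone M tt (ev h i i).
Proof.
by move=> i_n; rewrite evE; apply: rmhom1; apply: ord_inj; rewrite edge_arrow1 ?edge_arrow2.
Qed.

Lemma ev_mul n (h : N n) i j k : i <= j -> j <= k -> k <= n ->
  mul (ev h j k) (ev h i j) (ev h i k).
Proof.
move=> ij jk kn; have jn := leq_trans jk kn; have ik := leq_trans ij jk.
rewrite !evE; apply: rmhomM; split; apply: ord_inj.
- by rewrite edge_arrow2 // edge_arrow1.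
- by rewrite !edge_arrow1.
- by rewrite !edge_arrow2.
Qed.

Lemma ev_arrow n (h : N n) (p : chain n) : h p = ev h (sval p).1 (sval p).2.
Proof.
rewrite evE; congr (rmfun h _); have p12 := svalP p; have p2 := ltn_ord (sval p).2.
by apply: chain_arrow_ext; apply: ord_inj; rewrite ?edge_arrow1 ?edge_arrow2.
Qed.

Lemma ev_ext0 (h k : N 0) : ev h 0 0 = ev k 0 0 -> h = k.
Proof.
move=> hk; apply: rmhom_ext => p; rewrite !ev_arrow.
by rewrite [(sval p).1]ord1 [(sval p).2]ord1.
Qed.

(** Degenerate edges carry identities, which the other edges determine: at [i < n] as the source of
    the edge from [i] to [n], at [n] as the target of the edge from 0 to [n]. *)
Lemma ev_ext n (h k : N n) : 0 < n ->
  (forall i j, i < j -> j <= n -> ev h i j = ev k i j) -> h = k.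
Proof.
move=> n0 hk; apply: rmhom_ext => p; rewrite !ev_arrow.
have : (sval p).2 <= n by rewrite -ltnS.
move: (svalP p : (sval p).1 <= (sval p).2).
move: (nat_of_ord (sval p).1) (nat_of_ord (sval p).2) => i j.
rewrite leq_eqVlt => /orP[/eqP<- i_n|]; last exact: hk.
case: (ltngtP i n) => [lt_in||in_]; [|lia|].
  apply: (@rone_src _ (ev h i n)); try exact: ev_one; first exact: ev_mul.
  by rewrite hk //; exact: ev_mul.
subst i; apply: (@rone_tgt _ (ev h 0 n)); try exact: ev_one; first exact: ev_mul.
by rewrite hk //; exact: ev_mul.
Qed.

(** The identity at each vertex is read off from one edge with endpoint [n]; the triangles make all
    edges at that vertex agree on it. *)
Lemma nerve_exists n (v : nat -> nat -> M) : 1 < n ->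
  (forall i j k, i < j -> j < k -> k <= n -> mul (v j k) (v i j) (v i k)) ->
  exists h : N n, forall i j, i < j -> j <= n -> ev h i j = v i j.
Proof.
move=> n1 v_mul.
pose u i := if i == n then tgt (v 0 n) else src (v i n).
have u1 i : rone M tt (u i).
  by rewrite /u; case: eqP => _; [exact: rone_of_tgt|exact: rone_of_src].
have v_src i j : i < j -> j <= n -> mul (v i j) (u i) (v i j).
  move=> ij jn; rewrite /u ifF; last by lia.
  have -> : src (v i n) = src (v i j); last exact: mul_src.
  case: (ltngtP j n) => [lt_jn||->//]; last by lia.
  exact: src_mul (v_mul i j n ij lt_jn (leqnn _)).
have v_tgt i j : i < j -> j <= n -> mul (u j) (v i j) (v i j).
  move=> ij jn; have -> : u j = tgt (v i j); last exact: mul_tgt.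
  rewrite /u; case: eqP => [->|/eqP j_n].
    by case: i ij => [//|i] ij; apply: tgt_mul (v_mul 0 i.+1 n _ _ _); lia.
  by apply: src_tgt (v_mul i j n _ _ _); lia.
pose f (p : chain n) := let: (i, j) := sval p in if i == j :> nat then u i else v i j.
have f1 p : rone (chain n) tt p -> rone M tt (f p).
  by case: p => -[i j] ij; rewrite /= /chain_one /f /= => ->; rewrite eqxx.
have fM p q r : rmul (chain n) (p, q) r -> mul (f p) (f q) (f r).
  case: p q r => -[j k] jk [[i j'] ij] [[i' k'] ik] [/= ? ? ?]; subst j' i' k'.
  rewrite /f /=; have := ltn_ord k; move: ij jk ik => /=.
  move: (nat_of_ord i) (nat_of_ord j) (nat_of_ord k) => {}i {}j {}k ij jk ik kn.
  case: (ltngtP i j) ij => [ij _||-> _] //; case: (ltngtP j k) jk => [jk _||jk _] //.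
  - by rewrite ifF; [apply: v_mul|]; lia.
  - by rewrite -jk ifF; [apply: v_tgt|]; lia.
  - by apply: v_src => //; lia.
  - exact: roneM.
exists (RMHom f1 fM) => i j ij jn; rewrite evE /= /f.
move: (edge_arrow1 (ltnW ij) jn) (edge_arrow2 (ltnW ij) jn).
case: (sval _) => a b /= -> ->; by rewrite ltn_eqF.
Qed.

(** * Filling horns of a nerve by labelling edges *)

Section Filling.
Variables (n : nat) (P : pred nat) (y : nat -> N n.+1).

Definition edges_of (v : nat -> nat -> M) := forall p i j,
  p <= n.+2 -> P p -> i < j -> j <= n.+2 -> p != i -> p != j ->
  ev (s p (y p)) i j = v i j.

(** By [compat_glue], two faces containing the same edge give it the same label. *)
Lemma edges_exist : compat P y -> exists v, edges_of v.
Proof.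
move=> cy.
have /choice[v vE] (ij : nat * nat) : exists a, forall p,
    p <= n.+2 -> P p -> ij.1 < ij.2 -> ij.2 <= n.+2 -> p != ij.1 -> p != ij.2 ->
  ev (s p (y p)) ij.1 ij.2 = a.
  case: ij => i j /=.
  have [[q [qn Pq qi qj]]|no] := pselect (exists q, [/\ q <= n.+2, P q, q != i & q != j]).
    exists (ev (s q (y q)) i j) => p pn Pp ij jn pi pj.
    rewrite /ev (compat_glue cy pn qn) // => a; rewrite edgeE //; try exact: ltnW.
    - by case: ifP => _; rewrite eq_sym.
    - by case: ifP => _; rewrite eq_sym.
  (* This edge lies in no face of [P], so its label is an arbitrary default. *)
  by exists (ev (y 0) 0 0) => p *; case: no; exists p; split.
by exists (fun i j => v (i, j)) => p i j; exact: (vE (i, j)).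
Qed.

Variable v : nat -> nat -> M.
Hypothesis yv : edges_of v.

Lemma edges_mul p i j k : p <= n.+2 -> P p -> p \notin [:: i; j; k] ->
  i < j -> j < k -> k <= n.+2 -> mul (v j k) (v i j) (v i k).
Proof.
rewrite !inE !negb_or => pn Pp /and3P[pi pj pk] ij jk kn.
by rewrite -!(yv pn Pp) //; try lia; apply: ev_mul => //; exact: ltnW.
Qed.

Lemma fills_ev x p i j : fills P y x -> p <= n.+2 -> P p ->
  i < j -> j <= n.+2 -> p != i -> p != j -> ev x i j = v i j.
Proof.
move=> yx pn Pp ij jn pi pj; rewrite -(yv pn Pp) // /ev.
rewrite (fillsE yx pn Pp) // => a.
by rewrite edgeE; [case: ifP => _; rewrite eq_sym|exact: ltnW|].
Qed.

Lemma ev_s p (h : N n.+1) i j : p <= n.+2 -> i <= j -> j <= n.+1 ->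
  ev (s p h) (bump p i) (bump p j) = ev h i j.
Proof.
move=> pn ij jn; rewrite ev_act; [|rewrite /bump; lia..].
by congr ev; rewrite codegE inordK /bump /unbump; lia.
Qed.

(** A triangle inside some face of [P] is a product by [edges_mul]. Those left over have all of [P]
    among their vertices. *)
Lemma nerve_fill :
  (forall i j k, i < j -> j < k -> k <= n.+2 ->
     (forall p, p <= n.+2 -> P p -> p \in [:: i; j; k]) ->
     mul (v j k) (v i j) (v i k)) ->
  exists x, fills P y x.
Proof.
move=> v_mul; have [||x xv] := @nerve_exists n.+2 v; first by [].
  move=> i j k ij jk kn; have [all_p|] :=
    pselect (forall p, p <= n.+2 -> P p -> p \in [:: i; j; k]).
    exact: v_mul.
  move/existsNP => [p /not_implyP[pn /not_implyP[Pp /negP pijk]]].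
  exact: edges_mul pn Pp pijk ij jk kn.
exists x => p pn Pp; apply: ev_ext => // i j ij jn.
have d_ev : ev (d p x) i j = ev x (bump p i) (bump p j).
  by rewrite ev_act ?cofaceE ?inordK //; lia.
rewrite d_ev xv /bump; [|lia..].
rewrite -(yv pn Pp); [|lia..].
by apply: ev_s => //; lia.
Qed.

Lemma nerve_fill_unique x x' :
  (forall i j, i < j -> j <= n.+2 -> exists p, [/\ p <= n.+2, P p, p != i & p != j]) ->
  fills P y x -> fills P y x' -> x = x'.
Proof.
move=> cov yx yx'; apply: ev_ext => // i j ij jn.
have [p [pn Pp pi pj]] := cov i j ij jn.
by rewrite (fills_ev yx pn Pp) // (fills_ev yx' pn Pp).
Qed.

End Filling.
End NerveEdges.

(** * The nerve has the extension properties *)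

Definition frobenius_lifting (X : eset) :=
  [/\ forall n : nat, 1 <= n ->
        unique_extension_property X (sub_incl (@ehorn n ord0)) /\
        unique_extension_property X (sub_incl (@ehorn n ord_max)),
      forall n : nat, 3 <= n ->
        unique_extension_property X (sub_incl (boundary n))
    & extension_property X
        (sub_incl (sub_cup (@eface 4 (inord 1)) (@eface 4 (inord 3))))].

Section NerveLifting.
Variable F : frobenius.
Local Notation mul a b c := (rmul F (a, b) c).
Local Notation N := (nerve F).
Local Notation eps := (fun a : F => rcounit F a tt).

Let nd : nondegenerate eps := frobenius_nondegenerate F.

Lemma mark_ev (e : marks N) : edge_val (mark_edge e) = sval e.
Proof. exact: edge_ofK. Qed.

Lemma ev01 (h : N 1) : ev h 0 1 = edge_val h.
Proof. by rewrite /ev -long_edge_edge long_edge1 act_id. Qed.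

Lemma ev_d n (h : N n.+1) i j p : i <= j -> j <= n ->
  ev (d p h) i j = ev h (bump p i) (bump p j).
Proof.
by move=> ij jn; rewrite ev_act ?cofaceE ?inordK //; lia.
Qed.

Lemma nerve_d1 (h : N 1) (v : N 0) :
  d 1 h = v <-> mul (edge_val h) (ev v 0 0) (edge_val h).
Proof.
split=> [<-|hv].
  by rewrite -ev01 ev_d //; exact: ev_mul.
apply: ev_ext0; apply: (rone_src _ _ _ hv); try exact: ev_one.
by rewrite -ev01 ev_d //; exact: ev_mul.
Qed.

Lemma nerve_d0 (h : N 1) (v : N 0) :
  d 0 h = v <-> mul (ev v 0 0) (edge_val h) (edge_val h).
Proof.
split=> [<-|hv].
  by rewrite -ev01 ev_d //; exact: ev_mul.
apply: ev_ext0; apply: (rone_tgt _ _ _ hv); try exact: ev_one.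
by rewrite -ev01 ev_d //; exact: ev_mul.
Qed.

Lemma mark_inj (e e' : marks N) : sval e = sval e' -> e = e'.
Proof. by case: e e' => [a ea] [a' ea'] /=; exact: eq_exist. Qed.

(** Both elements are the left partner of the identity [u]. *)
Lemma eps_src_inj u e e' : rone F tt u -> eps e -> eps e' ->
  mul e u e -> mul e' u e' -> e = e'.
Proof.
move=> u1 ee ee' eu eu'; apply: (pairing_injl nd (a := u)).
  exact/(pairing_unitl nd).
exact/(pairing_unitl nd).
Qed.

Lemma eps_tgt_inj u e e' : rone F tt u -> eps e -> eps e' ->
  mul u e e -> mul u e' e' -> e = e'.
Proof.
move=> u1 ee ee' eu eu'; apply: (pairing_injr nd (b := u)).
  exact/(pairing_unitr nd).
exact/(pairing_unitr nd).
Qed.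

(** The marked edge out of [v] is the left partner [a] of the identity at [v]: their product is in
    [eps] and, by the unit law, is [a] itself. *)
Lemma nerve_mark_src (v : N 0) : exists! e : marks N, d 1 (mark_edge e) = v.
Proof.
have v1 := ev_one v (leqnn 0).
have [a [e [ee ae]]] := pairing_exl nd (ev v 0 0).
have ? := rmul1r v1 ae; subst e.
exists (exist _ a ee); split; first by apply/nerve_d1; rewrite mark_ev.
move=> e /nerve_d1; rewrite mark_ev => ev'; apply: mark_inj.
exact: (eps_src_inj v1 ee (svalP e) ae ev').
Qed.

Lemma nerve_mark_tgt (v : N 0) : exists! e : marks N, d 0 (mark_edge e) = v.
Proof.
have v1 := ev_one v (leqnn 0).
have [a [e [ee ae]]] := pairing_exr nd (ev v 0 0).
have ? := rmul1l v1 ae; subst e.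
exists (exist _ a ee); split; first by apply/nerve_d0; rewrite mark_ev.
move=> e /nerve_d0; rewrite mark_ev => ev'; apply: mark_inj.
exact: (eps_tgt_inj v1 ee (svalP e) ae ev').
Qed.

(** The partner of [a] works: its product with [a] is in [eps] and has the source of [e], hence is
    [e]. *)
Lemma complement_right a e u : rone F tt u -> mul a u a -> mul e u e -> eps e ->
  exists b, mul b a e.
Proof.
move=> u1 au eu ee; have [b [e' [ee' bae]]] := pairing_exl nd a; exists b.
by rewrite (eps_src_inj u1 ee ee' eu (mul_srcr bae u1 au)).
Qed.

Lemma complement_left b e u : rone F tt u -> mul u b b -> mul u e e -> eps e ->
  exists a, mul b a e.
Proof.
move=> u1 ub ue ee; have [a [e' [ee' bae]]] := pairing_exr nd b; exists a.
by rewrite (eps_tgt_inj u1 ee ee' ue (mul_tgtl bae u1 ub)).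
Qed.

Lemma mark_long n (P : pred nat) (y : nat -> N n.+1) v e j :
  edges_of P y v -> 0 < j < n.+2 -> P j ->
  act (long_edge n.+1) (y j) = mark_edge e -> v 0 n.+2 = sval e.
Proof.
move=> yv /andP[j0 jn] Pj ye; rewrite -(yv j) //; try lia.
by rewrite /ev -long_edge_edge act_long_edge_s // ye mark_ev.
Qed.

(** The horn consists of edges 01 and 02 with a common source, the latter in [eps]; the missing edge
    12 has to be the partner of 01. *)
Lemma nerve_ehorn2_l : unique_extension_property N (sub_incl (@ehorn 2 ord0)).
Proof.
rewrite (@ehornP _ 0) // => y cy [e ye].
have [v yv] := edges_exist cy.
have v02 : v 0 2 = sval e by apply: (mark_long (j := 1) yv) => //; exact: ye.
have v02' : v 0 2 = ev (y 1) 0 1 by rewrite -(yv 1) //; exact: (@ev_s _ 0 1 (y 1) 0 1).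
have v01 : v 0 1 = ev (y 2) 0 1 by rewrite -(yv 2) //; exact: (@ev_s _ 0 2 (y 2) 0 1).
have u_eq : ev (y 2) 0 0 = ev (y 1) 0 0.
  have := congr1 (fun h : N 0 => ev h 0 0) (cy 1 1 isT isT isT isT).
  by rewrite !ev_d.
have [z zv] : exists z, mul z (v 0 1) (v 0 2).
  apply: (@complement_right _ _ (ev (y 1) 0 0)); first exact: ev_one.
  - by rewrite v01 -u_eq; exact: ev_mul.
  - by rewrite v02'; exact: ev_mul.
  - by rewrite v02; exact: svalP e.
(* No face of the horn contains the edge 12, so [v 1 2] is only a default, to be replaced by [z]. *)
have [||x yx] :=
  @nerve_fill _ 0 (fun j => j != @ord0 2) y (fun i j => if i == 1 then z else v i j).
- move=> p i j p2 /= Pp ij j2 pi pj; rewrite (yv p) // ifF //.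
  by move: Pp; rewrite /=; lia.
- move=> i j k ij jk k2 _; have [-> [-> ->]] : i = 0 /\ j = 1 /\ k = 2 by lia.
  exact: zv.
exists x; split=> // x' yx'.
apply: ev_ext => // i j ij j2.
have E p : p != 0 -> p <= 2 -> p != i -> p != j -> ev x i j = ev x' i j.
  by move=> Pp p2 pi pj; rewrite (fills_ev yv yx p2 Pp) // (fills_ev yv yx' p2 Pp).
have [i0|i1] := eqVneq i 0.
  by have [j1|j1] := eqVneq j 1; [apply: (E 2)|apply: (E 1)]; lia.
have [-> ->] : i = 1 /\ j = 2 by lia.
have ev_v w : fills (fun j => j != @ord0 2) y w -> pairing eps (ev w 1 2) (v 0 1).
  move=> yw; exists (v 0 2); split; first by rewrite v02; exact: svalP e.
  rewrite -(fills_ev (p := 1) (i := 0) (j := 2) yv yw) //.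
  rewrite -(fills_ev (p := 2) (i := 0) (j := 1) yv yw) //.
  exact: ev_mul.
exact: pairing_injl nd _ _ _ (ev_v _ yx) (ev_v _ yx').
Qed.

Lemma nerve_ehorn2_r : unique_extension_property N (sub_incl (@ehorn 2 ord_max)).
Proof.
rewrite (@ehornP _ 0) // => y cy [e ye].
have [v yv] := edges_exist cy.
have v02 : v 0 2 = sval e by apply: (mark_long (j := 1) yv) => //; exact: ye.
have v02' : v 0 2 = ev (y 1) 0 1 by rewrite -(yv 1) //; exact: (@ev_s _ 0 1 (y 1) 0 1).
have v12 : v 1 2 = ev (y 0) 0 1 by rewrite -(yv 0) //; exact: (@ev_s _ 0 0 (y 0) 0 1).
have u_eq : ev (y 1) 1 1 = ev (y 0) 1 1.
  have := congr1 (fun h : N 0 => ev h 0 0) (cy 0 0 isT isT isT isT).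
  by rewrite !ev_d.
have [z zv] : exists z, mul (v 1 2) z (v 0 2).
  apply: (@complement_left _ _ (ev (y 1) 1 1)); first exact: ev_one.
  - by rewrite v12 u_eq; exact: ev_mul.
  - by rewrite v02'; exact: ev_mul.
  - by rewrite v02; exact: svalP e.
have [||x yx] :=
  @nerve_fill _ 0 (fun j => j != @ord_max 2) y (fun i j => if j == 1 then z else v i j).
- move=> p i j p2 /= Pp ij j2 pi pj; rewrite (yv p) // ifF //.
  by move: Pp; rewrite /=; lia.
- move=> i j k ij jk k2 _; have [-> [-> ->]] : i = 0 /\ j = 1 /\ k = 2 by lia.
  exact: zv.
exists x; split=> // x' yx'.
apply: ev_ext => // i j ij j2.
have E p : p != 2 -> p <= 2 -> p != i -> p != j -> ev x i j = ev x' i j.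
  by move=> Pp p2 pi pj; rewrite (fills_ev yv yx p2 Pp) // (fills_ev yv yx' p2 Pp).
have [j2'|j1] := eqVneq j 2.
  by have [i1|i1] := eqVneq i 1; [apply: (E 0)|apply: (E 1)]; lia.
have [-> ->] : i = 0 /\ j = 1 by lia.
have ev_v w : fills (fun j => j != @ord_max 2) y w -> pairing eps (v 1 2) (ev w 0 1).
  move=> yw; exists (v 0 2); split; first by rewrite v02; exact: svalP e.
  rewrite -(fills_ev (p := 1) (i := 0) (j := 2) yv yw) //.
  rewrite -(fills_ev (p := 0) (i := 1) (j := 2) yv yw) //.
  exact: ev_mul.
exact: pairing_injr nd _ _ _ (ev_v _ yx) (ev_v _ yx').
Qed.

(** All edges are present. A triangle in no face of the horn has all of 1, ..., [n.+3] as vertices,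
    so it is 123 in dimension 3, and [rotate] supplies it. *)
Lemma nerve_ehorn3_l n : unique_extension_property N (sub_incl (@ehorn n.+3 ord0)).
Proof.
rewrite (@ehornP _ n.+1) // => y cy [e ye].
have [v yv] := edges_exist cy.
have ve : v 0 n.+3 = sval e by apply: (mark_long (j := 1) yv) => //; exact: ye.
have [|x yx] := nerve_fill yv.
  move=> i j k ij jk kn all_p.
  have [n0 [i1 [j2 k3]]] : n = 0 /\ i = 1 /\ j = 2 /\ k = 3.
    have := (all_p 1 isT isT, all_p 2 isT isT, all_p 3 isT isT, all_p 4 ^~ isT).
    by rewrite !inE => -[[[]]]; lia.
  subst n i j k.
  have v_mul p i j k := @edges_mul _ _ _ _ _ yv p i j k.
  have e_eps : eps (v 0 3) by rewrite ve; exact: svalP e.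
  apply: (@rotate _ _ nd _ (v 0 1) (v 0 2)).
  - exact: (v_mul 3 0 1 2).
  - by exists (v 0 3); split=> //; exact: (v_mul 1 0 2 3).
  - by exists (v 0 3); split=> //; exact: (v_mul 2 0 1 3).
exists x; split=> // x' yx'; apply: (nerve_fill_unique yv _ yx yx').
move=> i j ij jn.
have [/andP[i1 j1]|] := boolP ((1 != i) && (1 != j)); first by exists 1.
have [/andP[i2 j2] _|] := boolP ((2 != i) && (2 != j)); first by exists 2.
by exists 3; split; rewrite //=; lia.
Qed.

(** Mirror image: the only triangle that can be absent is 012 in dimension 3, supplied by
    [unrotate]. *)
Lemma nerve_ehorn3_r n : unique_extension_property N (sub_incl (@ehorn n.+3 ord_max)).
Proof.
rewrite (@ehornP _ n.+1) // => y cy [e ye].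
have [v yv] := edges_exist cy.
have ve : v 0 n.+3 = sval e by apply: (mark_long (j := 1) yv) => //; exact: ye.
have [|x yx] := nerve_fill yv.
  move=> i j k ij jk kn all_p.
  have [n0 [i1 [j2 k3]]] : n = 0 /\ i = 0 /\ j = 1 /\ k = 2.
    have := (all_p 0 isT isT, all_p 1 isT isT, all_p 2 isT isT, fun h => all_p 3 isT h).
    by rewrite !inE /= => -[[[]]]; lia.
  subst n i j k.
  have v_mul p i j k := @edges_mul _ _ _ _ _ yv p i j k.
  have e_eps : eps (v 0 3) by rewrite ve; exact: svalP e.
  apply: (@unrotate _ _ nd _ _ _ (v 2 3) (v 1 3)).
  - exact: (v_mul 0 1 2 3).
  - by exists (v 0 3); split=> //; exact: (v_mul 1 0 2 3).
  - by exists (v 0 3); split=> //; exact: (v_mul 2 0 1 3).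
exists x; split=> // x' yx'; apply: (nerve_fill_unique yv _ yx yx').
move=> i j ij jn.
have [/andP[i1 j1]|] := boolP ((1 != i) && (1 != j)); first by exists 1.
have [/andP[i2 j2] _|] := boolP ((2 != i) && (2 != j)); first by exists 2.
by exists 0; split; rewrite //=; lia.
Qed.

(** No triangle contains the four vertices 0, 1, 2, 3, so each one lies in a face of the
    boundary. *)
Lemma nerve_boundary n : unique_extension_property N (sub_incl (boundary n.+3)).
Proof.
rewrite (@boundaryP _ n.+1) // => y cy; have [v yv] := edges_exist cy.
have [|x yx] := nerve_fill yv.
  move=> i j k ij jk kn all_p.
  have := (all_p 0 isT isT, all_p 1 isT isT, all_p 2 isT isT, all_p 3 isT isT).
  by rewrite !inE => -[[[]]]; lia.
exists x; split=> // x' yx'; apply: (nerve_fill_unique yv _ yx yx').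
move=> i j ij jn.
have [/andP[i1 j1]|] := boolP ((1 != i) && (1 != j)); first by exists 1.
have [/andP[i2 j2] _|] := boolP ((2 != i) && (2 != j)); first by exists 2.
by exists 0; split=> //; lia.
Qed.

(** Among edges and triangles, only 13, 013, 123 and 134 lie in neither face. Associativity along 0,
    1, 2, 3 produces the edge 13 together with 013 and 123; then [rotate], with the edge 04 in
    [eps], gives 134. *)
Lemma nerve_two_faces : extension_property N
  (sub_incl (sub_cup (@eface 4 (inord 1)) (@eface 4 (inord 3)))).
Proof.
apply/two_facesP => y1 y3 y13 [e y1e].
pose P j := (j == 1) || (j == 3).
pose y j := if j == 1 then y1 else y3.
have cy : compat P y.
  by move=> i j ij j3 /orP[]/eqP i1 /orP[]/eqP[j1]; subst i j.
have [v yv] := edges_exist cy.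
have v_mul p i j k := @edges_mul _ _ _ _ _ yv p i j k.
have e_eps : eps (v 0 4).
  rewrite -(yv 1) // -[0]/(bump 1 0) -[4]/(bump 1 3) ev_s //.
  rewrite -[0]/(bump 1 0) -[3]/(bump 1 2) -ev_d //.
  rewrite -[0]/(bump 1 0) -[2]/(bump 1 1) -ev_d //.
  by rewrite y1e ev01 mark_ev; exact: svalP e.
have [|z [z123 z013]] := (rmulA (v 2 3) (v 1 2) (v 0 1) (v 0 3)).2.
  by exists (v 0 2); split; [exact: (v_mul 3)|exact: (v_mul 1)].
have z134 : mul (v 3 4) z (v 1 4).
  apply: (@rotate _ _ nd _ (v 0 1) (v 0 3)) => //.
  - by exists (v 0 4); split=> //; exact: (v_mul 1).
  - by exists (v 0 4); split=> //; exact: (v_mul 3).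
pose w i j := if (i == 1) && (j == 3) then z else v i j.
have [||x yx] := @nerve_fill _ 2 P y w.
- move=> p i j p4 Pp ij j4 pi pj; rewrite (yv p) // /w ifF //.
  by move: Pp; rewrite /P; lia.
- move=> i j k ij jk k4 all_p.
  have : [\/ i = 0 /\ j = 1 /\ k = 3, i = 1 /\ j = 2 /\ k = 3 | i = 1 /\ j = 3 /\ k = 4].
    have := (all_p 1 isT isT, all_p 3 isT isT); rewrite !inE => -[] A B.
    have [i0|i0] := eqVneq i 0; first by apply: Or31; lia.
    by have [j2|j2] := eqVneq j 2; [apply: Or32|apply: Or33]; lia.
  by case=> -[-> [-> ->]].
by exists x; split; [exact: (yx 1)|exact: (yx 3)].
Qed.

Theorem nerve_lifting : frobenius_lifting N.
Proof.
split; last exact: nerve_two_faces.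
- case=> [|[|[|n]]] // _.
  + split; apply/ehorn1P; [exact: nerve_mark_src|exact: nerve_mark_tgt].
  + by split; [exact: nerve_ehorn2_l|exact: nerve_ehorn2_r].
  + by split; [exact: nerve_ehorn3_l|exact: nerve_ehorn3_r].
- by case=> [|[|[|n]]] // _; exact: nerve_boundary.
Qed.

End NerveLifting.

(** * The Frobenius algebra of edges *)

Lemma boundary_inj (X : eset) n (x x' : X n.+2) :
  unique_extension_property X (sub_incl (boundary n.+2)) ->
  (forall i, i <= n.+2 -> d i x = d i x') -> x = x'.
Proof.
move=> /boundaryP ext xx'; have [|z [_ z_uniq]] := ext (fun i => d i x).
  by move=> i j ij _ _ _; exact: dd.
by rewrite -(z_uniq x) // (z_uniq x') // => i i_n _; rewrite xx'.
Qed.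

Lemma act_long_edge_d (X : sset) n i (x : X n.+1) : 0 < i -> i < n.+1 ->
  act (long_edge n) (d i x) = act (long_edge n.+1) x.
Proof.
move=> i0 i_n; rewrite /d -act_comp; apply: act_eq => a.
by rewrite delta_compE cofaceE !long_edgeE /bump; case: ifP => _; lia.
Qed.

Lemma ehorn_inj (X : eset) n (i : 'I_n.+3) (x x' : X n.+2) e : i != 1 :> nat ->
  unique_extension_property X (sub_incl (ehorn i)) ->
  act (long_edge n.+2) x = mark_edge e ->
  (forall j, j <= n.+2 -> j != i -> d j x = d j x') -> x = x'.
Proof.
move=> i1 /(ehornP X i1) ext xe xx'; have [||z [_ z_uniq]] := ext (fun i => d i x).
- by move=> j k jk _ _ _; exact: dd.
- by exists e => j /andP[j0 jn] _; rewrite act_long_edge_d.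
by rewrite -(z_uniq x) // (z_uniq x') // => j jn ji; rewrite xx'.
Qed.

Lemma act_long_edge2 (X : sset) (t : X 2) : act (long_edge 2) t = d 1 t.
Proof. by rewrite -(@act_long_edge_d _ _ 1) // long_edge1 act_id. Qed.

Lemma act_long_edge3 (X : sset) (t : X 3) : act (long_edge 3) t = d 1 (d 1 t).
Proof. by rewrite -(@act_long_edge_d _ _ 1) // act_long_edge2. Qed.

Section Converse.
Variable X : eset.
Hypothesis lift : frobenius_lifting X.

Let ext_l n : unique_extension_property X (sub_incl (@ehorn n.+1 ord0)).
Proof. by have [/(_ n.+1 isT)[]] := lift. Qed.

Let ext_r n : unique_extension_property X (sub_incl (@ehorn n.+1 ord_max)).
Proof. by have [/(_ n.+1 isT)[]] := lift. Qed.

Let ext_b n : unique_extension_property X (sub_incl (boundary n.+3)).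
Proof. by have [_ /(_ n.+3 isT)] := lift. Qed.

Lemma mark_src (v : X 0) : exists! e, d 1 (mark_edge e) = v.
Proof. exact: ((@ehorn1P X ord0).1 (@ext_l 0) v). Qed.

Lemma mark_tgt (v : X 0) : exists! e, d 0 (mark_edge e) = v.
Proof. exact: ((@ehorn1P X ord_max).1 (@ext_r 0) v). Qed.

Lemma mark_src_inj (e e' : marks X) :
  d 1 (mark_edge e) = d 1 (mark_edge e') -> e = e'.
Proof. by have [f [_ fu]] := mark_src (d 1 (mark_edge e')) => /fu <-; exact: fu. Qed.

Lemma mark_tgt_inj (e e' : marks X) :
  d 0 (mark_edge e) = d 0 (mark_edge e') -> e = e'.
Proof. by have [f [_ fu]] := mark_tgt (d 0 (mark_edge e')) => /fu <-; exact: fu. Qed.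

(** This and the next lemmas spell out the horns with marked long edge in low dimensions: [l] leaves
    out the face opposite the first vertex, [r] the one opposite the last. *)
Lemma horn2l (b : X 1) e : d 1 b = d 1 (mark_edge e) ->
  exists t : X 2, d 1 t = mark_edge e /\ d 2 t = b.
Proof.
move=> be; have [||t [tP _]] := (@ehornP X 0 ord0 isT).1 (@ext_l 1)
    (fun j => if j == 1 then mark_edge e else b).
- by case=> [|[|i]] [|[|j]].
- by exists e => -[|[|j]] //= _ _; rewrite long_edge1 act_id.
by exists t; split; [exact: (tP 1)|exact: (tP 2)].
Qed.

Lemma horn2r (a : X 1) e : d 0 a = d 0 (mark_edge e) ->
  exists t : X 2, d 0 t = a /\ d 1 t = mark_edge e.
Proof.
move=> ae; have [||t [tP _]] := (@ehornP X 0 ord_max isT).1 (@ext_r 1)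
    (fun j => if j == 1 then mark_edge e else a).
- by case=> [|[|i]] [|[|j]].
- by exists e => -[|[|j]] //= _ _; rewrite long_edge1 act_id.
by exists t; split; [exact: (tP 0)|exact: (tP 1)].
Qed.

Lemma horn3l (t1 t2 t3 : X 2) e :
  d 1 t2 = d 1 t1 -> d 1 t3 = d 2 t1 -> d 2 t3 = d 2 t2 -> d 1 t1 = mark_edge e ->
  exists x : X 3, [/\ d 1 x = t1, d 2 x = t2 & d 3 x = t3].
Proof.
move=> t12 t13 t23 t1e; have [||x [xP _]] := (@ehornP X 1 ord0 isT).1 (@ext_l 2)
    (fun j => if j == 1 then t1 else if j == 2 then t2 else t3).
- by case=> [|[|[|i]]] [|[|[|j]]].
- by exists e => -[|[|[|j]]] //= _ _; rewrite act_long_edge2 ?t12 t1e.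
by exists x; split; [exact: (xP 1)|exact: (xP 2)|exact: (xP 3)].
Qed.

Lemma horn3r (t0 t1 t2 : X 2) e :
  d 0 t1 = d 0 t0 -> d 0 t2 = d 1 t0 -> d 1 t2 = d 1 t1 -> d 1 t1 = mark_edge e ->
  exists x : X 3, [/\ d 0 x = t0, d 1 x = t1 & d 2 x = t2].
Proof.
move=> t01 t02 t12 t1e; have [||x [xP _]] := (@ehornP X 1 ord_max isT).1 (@ext_r 2)
    (fun j => if j == 0 then t0 else if j == 1 then t1 else t2).
- by case=> [|[|[|i]]] [|[|[|j]]].
- by exists e => -[|[|[|j]]] //= _ _; rewrite act_long_edge2 ?t12 t1e.
by exists x; split; [exact: (xP 0)|exact: (xP 1)|exact: (xP 2)].
Qed.

Lemma horn2l_inj (t t' : X 2) e : d 1 t = mark_edge e ->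
  d 1 t = d 1 t' -> d 2 t = d 2 t' -> t = t'.
Proof.
move=> te t1 t2; apply: (@ehorn_inj X 0 ord0 t t' e _ (@ext_l 1)) => //.
  by rewrite act_long_edge2.
by case=> [|[|[|j]]].
Qed.

Lemma horn2r_inj (t t' : X 2) e : d 1 t = mark_edge e ->
  d 0 t = d 0 t' -> d 1 t = d 1 t' -> t = t'.
Proof.
move=> te t0 t1; apply: (@ehorn_inj X 0 ord_max t t' e _ (@ext_r 1)) => //.
  by rewrite act_long_edge2.
by case=> [|[|[|j]]].
Qed.

Lemma horn3r_inj (x x' : X 3) e : d 1 (d 1 x) = mark_edge e ->
  d 0 x = d 0 x' -> d 1 x = d 1 x' -> d 2 x = d 2 x' -> x = x'.
Proof.
move=> xe x0 x1 x2; apply: (@ehorn_inj X 1 ord_max x x' e _ (@ext_r 2)) => //.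
  by rewrite act_long_edge3.
by case=> [|[|[|[|j]]]].
Qed.

Lemma horn4l (x1 x2 x3 x4 : X 3) e :
  d 1 x2 = d 1 x1 -> d 1 x3 = d 2 x1 -> d 1 x4 = d 3 x1 -> d 2 x3 = d 2 x2 ->
  d 2 x4 = d 3 x2 -> d 3 x4 = d 3 x3 -> d 1 (d 1 x1) = mark_edge e ->
  exists w : X 4, [/\ d 1 w = x1, d 2 w = x2, d 3 w = x3 & d 4 w = x4].
Proof.
move=> x12 x13 x14 x23 x24 x34 x1e.
have [||w [wP _]] := (@ehornP X 2 ord0 isT).1 (@ext_l 3)
    (fun j => if j == 1 then x1 else if j == 2 then x2 else if j == 3 then x3 else x4).
- by case=> [|[|[|[|i]]]] [|[|[|[|j]]]].
- exists e => -[|[|[|[|j]]]] //= _ _; rewrite act_long_edge3 ?x12 ?x13 //.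
  by rewrite dd.
by exists w; split; [exact: (wP 1)|exact: (wP 2)|exact: (wP 3)|exact: (wP 4)].
Qed.

Lemma sphere3 (t0 t1 t2 t3 : X 2) :
  d 0 t1 = d 0 t0 -> d 0 t2 = d 1 t0 -> d 0 t3 = d 2 t0 ->
  d 1 t2 = d 1 t1 -> d 1 t3 = d 2 t1 -> d 2 t3 = d 2 t2 ->
  exists x : X 3, [/\ d 0 x = t0, d 1 x = t1, d 2 x = t2 & d 3 x = t3].
Proof.
move=> t01 t02 t03 t12 t13 t23.
have [|x [xP _]] := (@boundaryP X 1).1 (@ext_b 0)
    (fun j => if j == 0 then t0 else if j == 1 then t1 else if j == 2 then t2 else t3).
  by case=> [|[|[|[|i]]]] [|[|[|[|j]]]].
by exists x; split; [exact: (xP 0)|exact: (xP 1)|exact: (xP 2)|exact: (xP 3)].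
Qed.

(* On vertices 0, 0', 1, 2, the sphere with faces [t], [t'] and two degenerate
   triangles has a filler; coning it off with a vertex 4 such that 04 is marked
   exhibits [t] and [t'] as faces of 3-simplices with the same other faces. *)
Lemma triangle_inj (t t' : X 2) :
  d 0 t = d 0 t' -> d 1 t = d 1 t' -> d 2 t = d 2 t' -> t = t'.
Proof.
move=> t0 t1 t2; have [e [ev _]] := mark_src (d 1 (d 1 t)).
have [|T1 [T1e T1t]] := @horn2l (d 1 t) e; first by rewrite ev.
have [|T2 [T2e T2t]] := @horn2l (d 2 t) e; first by rewrite ev dd.
have [r [r0 r1 r2 r3]] : exists r : X 3,
    [/\ d 0 r = t, d 1 r = t', d 2 r = s 0 (d 1 t) & d 3 r = s 0 (d 2 t)].
  by apply: sphere3; rewrite ?ds ?dSs ?ds_gt // dd.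
have [x [x1 x2 x3]] : exists x : X 3, [/\ d 1 x = T1, d 2 x = T2 & d 3 x = t'].
  by apply: (@horn3l _ _ _ e); rewrite ?T1e ?T2e ?T1t ?T2t.
have [w [w1 w2 w3 w4]] : exists w : X 4,
    [/\ d 1 w = x, d 2 w = s 0 T1, d 3 w = s 0 T2 & d 4 w = r].
  by apply: (@horn4l _ _ _ _ e);
    rewrite ?x1 ?x2 ?x3 ?r1 ?r2 ?r3 ?dSs ?ds_gt ?ds_gt ?T1e ?T2e ?T1t ?T2t.
have w01 : d 1 (d 0 w) = T1 by rewrite -dd // w2 ds.
(* The simplices [d 0 w] and [x] share all faces but the last, and their long edge is marked, so
   they coincide. Their last faces are [t] and [t']. *)
have wx : d 0 w = x.
  apply: (@horn3r_inj _ _ e); first by rewrite w01.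
  - by rewrite -dd // w1.
  - by rewrite w01 x1.
  - by rewrite -dd // w3 ds.
by rewrite -[t]r0 -w4 dd // wx x3.
Qed.

(** Cone [t] off with a last vertex joined to [v] by a marked edge. The faces of the cone opposite 0
    and 1 agree on a right horn, hence coincide, and they contain [d 0 t] and [d 1 t] as
    corresponding edges. *)
Lemma degenerate_l (t : X 2) v : d 2 t = s 0 v -> d 0 t = d 1 t.
Proof.
move=> t2; have v_eq : d 1 (d 1 t) = v by rewrite -dd // t2 dSs.
have [e [ev _]] := mark_src v.
have [|T [Te Tt]] := @horn2l (d 1 t) e; first by rewrite v_eq ev.
have [x [x1 x2 x3]] : exists x : X 3,
    [/\ d 1 x = T, d 2 x = s 0 (mark_edge e) & d 3 x = t].
  by apply: (@horn3l _ _ _ e); rewrite ?dSs ?ds_gt ?Te ?Tt ?t2 ?ev.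
have x01 : d 1 (d 0 x) = mark_edge e by rewrite -dd // x2 ds.
have <- : d 2 (d 0 x) = d 0 t by rewrite -dd // x3.
rewrite -Tt; congr d; apply: (@horn2r_inj _ _ e) => //; last by rewrite x01 Te.
by rewrite -dd // x1.
Qed.

Lemma degenerate_r (t : X 2) v : d 0 t = s 0 v -> d 1 t = d 2 t.
Proof.
move=> t0; have v_eq : d 0 (d 1 t) = v by rewrite dd // t0 ds.
have [e [ev _]] := mark_tgt v.
have [|T [Tt Te]] := @horn2r (d 1 t) e; first by rewrite v_eq ev.
have [x [x0 x1 x2]] : exists x : X 3,
    [/\ d 0 x = t, d 1 x = s 1 (mark_edge e) & d 2 x = T].
  by apply: (@horn3r _ _ _ e); rewrite ?ds ?ds_lt ?Te ?Tt ?t0 ?ev.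
have x13 : d 1 (d 3 x) = mark_edge e by rewrite dd // x1 dSs.
have <- : d 0 (d 3 x) = d 2 t by rewrite dd // x0.
rewrite -Tt; congr d; apply: (@horn2l_inj _ _ e); rewrite ?Te ?x13 //.
by rewrite dd // x2.
Qed.

(** Puts a new vertex before those of [t], joined to the last one by the marked edge; [cone_l] puts
    one after them. *)
Lemma cone_r (t : X 2) e : d 0 (d 0 t) = d 0 (mark_edge e) ->
  exists x : X 3, d 0 x = t /\ d 1 (d 1 x) = mark_edge e.
Proof.
move=> te; have [|T1 [T1t T1e]] := @horn2r (d 0 t) e; first by [].
have [|T2 [T2t T2e]] := @horn2r (d 1 t) e; first by rewrite dd.
have [x [x0 x1 x2]] : exists x : X 3, [/\ d 0 x = t, d 1 x = T1 & d 2 x = T2].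
  by apply: (@horn3r _ _ _ e); rewrite ?T1e ?T2e ?T1t ?T2t.
by exists x; rewrite x1.
Qed.

Lemma cone_l (t : X 2) e : d 1 (d 1 t) = d 1 (mark_edge e) ->
  exists x : X 3, d 3 x = t /\ d 1 (d 1 x) = mark_edge e.
Proof.
move=> te; have [|T1 [T1e T1t]] := @horn2l (d 1 t) e; first by [].
have [|T2 [T2e T2t]] := @horn2l (d 2 t) e; first by rewrite -te dd.
have [x [x1 x2 x3]] : exists x : X 3, [/\ d 1 x = T1, d 2 x = T2 & d 3 x = t].
  by apply: (@horn3l _ _ _ e); rewrite ?T1e ?T2e ?T1t ?T2t.
by exists x; rewrite x1.
Qed.

Lemma two_faces (y1 y3 : X 3) e : d 1 y3 = d 2 y1 -> d 1 (d 1 y1) = mark_edge e ->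
  exists x : X 4, d 1 x = y1 /\ d 3 x = y3.
Proof.
by case: lift => _ _ /two_facesP ext y13 y1e; apply: ext y13 _; exists e.
Qed.

(** Number the square 1, 2, 3, 4, so that [t1] is 234 and [t2] is 124, and cone both off from a
    vertex 0 with 04 marked. The cones agree on 024 by uniqueness for right horns, so they are the
    faces 3 and 1 of some 4-simplex, whose face opposite 0 is the desired tetrahedron. *)
Lemma flip_r (t1 t2 : X 2) : d 1 t1 = d 0 t2 ->
  exists x : X 3, d 0 x = t1 /\ d 2 x = t2.
Proof.
move=> t12; have [e [ev _]] := mark_tgt (d 0 (d 0 t1)).
have [|y1 [y1t y1e]] := @cone_r t1 e; first by rewrite ev.
have [|y3 [y3t y3e]] := @cone_r t2 e; first by rewrite ev -t12 dd.
have y13 : d 1 y3 = d 2 y1.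
  apply: (@horn2r_inj _ _ e) => //.
    by rewrite (@dd _ _ 0 0) // y3t dd // y1t.
  by rewrite y3e (@dd _ _ 1 1) // y1e.
have [w [w1 w3]] := two_faces y13 y1e.
exists (d 0 w); split; first by rewrite -dd // w1.
by rewrite -dd // w3.
Qed.

(** The same with the square numbered 0, 1, 2, 3 and the cone vertex 4 placed last; the diagonal is
    now 02. *)
Lemma flip_l (t1 t2 : X 2) : d 1 t1 = d 2 t2 ->
  exists x : X 3, d 3 x = t1 /\ d 1 x = t2.
Proof.
move=> t12; have [e [ev _]] := mark_src (d 1 (d 1 t1)).
have [|y3 [y3t y3e]] := @cone_l t1 e; first by rewrite ev.
have [|y1 [y1t y1e]] := @cone_l t2 e; first by rewrite ev t12 (@dd _ _ 1 1).
have y13 : d 1 y3 = d 2 y1.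
  apply: (@horn2l_inj _ _ e) => //.
    by rewrite y3e dd.
  by rewrite -dd // y3t t12 -y1t -(@dd _ _ 2 2).
have [w [w1 w3]] := two_faces y13 y1e.
exists (d 4 w); split; first by rewrite dd // w3.
by rewrite dd // w1.
Qed.

Definition edge_mul : hrel (X 1 * X 1) (X 1) :=
  fun ab c => exists t : X 2, [/\ d 0 t = ab.1, d 2 t = ab.2 & d 1 t = c].

Definition edge_one : hrel unit (X 1) := fun _ a => exists v : X 0, a = s 0 v.

(** The two bracketings of a triple product are the two triangulations of a square, exchanged by the
    flips. Degenerate triangles give existence in the unit laws, and [degenerate_l] and
    [degenerate_r] give uniqueness. *)
Lemma edge_monoid : is_monoid edge_mul edge_one.
Proof.
split.
- apply/funext => -[[a b] c]; apply/funext => z; rewrite propeqE; split.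
    case=> -[ab c'] [[/= [t1 [t10 t12 t11]]]]; rewrite /rid => cc; subst c'.
    case=> t2 [/= t20 t22 t21].
    have [|w [w0 w2]] := @flip_r t1 t2; first by rewrite t11 t20.
    exists (a, (b, c)); split=> //; exists (a, d 1 (d 3 w)); split.
      split=> //=; exists (d 3 w); split=> //=; first by rewrite dd // w0.
      by rewrite dd // w2.
    exists (d 1 w); split=> /=; first by rewrite dd // w0.
      by rewrite -dd.
    by rewrite -dd // w2.
  case=> _ [<-] [[a' bc]] [[/=]]; rewrite /rid => aa [t1 [t10 t12 t11]]; subst a'.
  case=> t2 [/= t20 t22 t21].
  have [|w [w3 w1]] := @flip_l t1 t2; first by rewrite t11 t22.
  exists (d 1 (d 0 w), c); split.
    split=> //=; exists (d 0 w); split=> //=; first by rewrite -dd // w1.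
    by rewrite -dd // w3.
  exists (d 2 w); split=> /=; first by rewrite dd.
    by rewrite -dd // w3.
  by rewrite dd // w1.
- apply/funext => -[[] a]; apply/funext => c; rewrite propeqE; split.
    case=> -[u a'] [[/= [v uv]]]; rewrite /rid => aa; subst a' u.
    by case=> t [/= /degenerate_r t12 <- <-]; rewrite t12.
  move=> /= <-; exists (s 0 (d 0 a), a); split; first by split=> //; exists (d 0 a).
  by exists (s 1 a); split=> /=; rewrite ?dSs ?ds ?ds_lt.
- apply/funext => -[a []]; apply/funext => c; rewrite propeqE; split.
    case=> -[a' u] [[/=]]; rewrite /rid => aa [v uv]; subst a' u.
    by case=> t [/= <- /degenerate_l -> <-].
  move=> /= <-; exists (a, s 0 (d 1 a)); split; first by split=> //; exists (d 1 a).
  by exists (s 0 a); split=> /=; rewrite ?dSs ?ds ?ds_gt.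
Qed.

Definition edges : rmonoid := RMonoid edge_monoid.

Definition marked (a : edges) : Prop := exists e, mark_edge e = a.

(** The partner of [a] is the missing edge of the 2-horn formed by [a] and the unique marked edge
    with the same source, respectively target. *)
Lemma marked_nondegenerate : nondegenerate marked.
Proof.
split=> a.
  have [e [ev _]] := mark_src (d 1 a).
  have [|t [te ta]] := @horn2l a e; first by [].
  exists (d 0 t); split.
    by exists (mark_edge e); split; [exists e|exists t].
  move=> b [_ [[e' <-] [t' [/= <- t'a t'e]]]]; congr d.
  have ee : e' = e by apply: mark_src_inj; rewrite ev -t'e -dd ?t'a.
  by subst e'; apply: (@horn2l_inj _ _ e); rewrite ?te ?ta ?t'e ?t'a.
have [e [ev _]] := mark_tgt (d 0 a).
have [|t [ta te]] := @horn2r a e; first by [].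
exists (d 2 t); split.
  by exists (mark_edge e); split; [exists e|exists t].
move=> b [_ [[e' <-] [t' [/= t'a <- t'e]]]]; congr d.
have ee : e' = e by apply: mark_tgt_inj; rewrite ev -t'e dd ?t'a.
by subst e'; apply: (@horn2r_inj _ _ e); rewrite ?te ?ta ?t'e ?t'a.
Qed.

Definition edge_frobenius : frobenius := form_frobenius marked_nondegenerate.

End Converse.

(** * Comparison with the nerve *)

(** The inverse is chosen pointwise, and injectivity makes it natural. *)
Lemma bijective_eset_iso (X Y : eset) (f : emor X Y) :
  (forall n (x x' : X n), emor_simp f x = emor_simp f x' -> x = x') ->
  (forall n (y : Y n), exists x, emor_simp f x = y) ->
  (forall e e', emor_mark f e = emor_mark f e' -> e = e') ->
  (forall e, exists e', emor_mark f e' = e) ->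
  eset_iso X Y.
Proof.
move=> f_inj f_surj fm_inj fm_surj.
pose g n (y : Y n) : X n := sval (cid (f_surj n y)).
pose gm (e : marks Y) : marks X := sval (cid (fm_surj e)).
have gK n y : emor_simp f (g n y) = y by rewrite /g; case: cid.
have gmK e : emor_mark f (gm e) = e by rewrite /gm; case: cid.
have g_act m n (h : delta m n) y : g m (act h y) = act h (g n y).
  by apply: f_inj; rewrite emor_act !gK.
have g_edge e : g 1 (mark_edge e) = mark_edge (gm e).
  by apply: f_inj; rewrite emor_edge gK gmK.
exists f, (EMor g_act g_edge); split; apply: emor_ext => [n x|e] /=.
- by apply: f_inj; rewrite gK.
- by apply: fm_inj; rewrite gmK.
- exact: gK.
- exact: gmK.
Qed.

Lemma emor_compA (X Y Z W : eset) (h : emor Z W) (g : emor Y Z) (f : emor X Y) :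
  emor_comp h (emor_comp g f) = emor_comp (emor_comp h g) f.
Proof. exact: emor_ext. Qed.

Lemma emor_comp1l (X Y : eset) (f : emor X Y) : emor_comp (emor_id Y) f = f.
Proof. exact: emor_ext. Qed.

(** * Invariance of the extension properties under isomorphism *)

Section Invariance.
Variables (X Y : eset) (f : emor X Y) (g : emor Y X).
Hypotheses (gf : emor_comp g f = emor_id X) (fg : emor_comp f g = emor_id Y).

Lemma extension_iso A B (m : emor A B) :
  extension_property Y m -> extension_property X m.
Proof.
move=> ext h; have [k km] := ext (emor_comp f h); exists (emor_comp g k).
by rewrite -emor_compA km emor_compA gf emor_comp1l.
Qed.

Lemma unique_extension_iso A B (m : emor A B) :
  unique_extension_property Y m -> unique_extension_property X m.
Proof.
move=> ext h; have [k [km k_uniq]] := ext (emor_comp f h); exists (emor_comp g k).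
split=> [|l lm]; first by rewrite -emor_compA km emor_compA gf emor_comp1l.
rewrite (k_uniq (emor_comp f l)); last by rewrite -emor_compA lm.
by rewrite emor_compA gf emor_comp1l.
Qed.

Lemma frobenius_lifting_iso : frobenius_lifting Y -> frobenius_lifting X.
Proof.
case=> horns bdry faces; split; last exact: extension_iso.
  by move=> n n1; have [l r] := horns n n1; split; exact: unique_extension_iso.
by move=> n n3; apply: unique_extension_iso; exact: bdry.
Qed.

End Invariance.

Lemma triangle_subproof n i j k (a b : 'I_3) : a <= b ->
  (inord (nth 0 [:: minn i (minn j (minn k n)); minn j (minn k n); minn k n] a)
     : 'I_n.+1) <=
  (inord (nth 0 [:: minn i (minn j (minn k n)); minn j (minn k n); minn k n] b)
     : 'I_n.+1).
Proof.
by case: a b => [[|[|[|a]]] la] [[|[|[|b]]] lb] //= _; rewrite !inordK; lia.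
Qed.

(* Meaningful for [i <= j <= k <= n]; out of range indices are truncated. *)
Definition triangle n i j k : delta 2 n := mk_delta (@triangle_subproof n i j k).

Lemma triangleE n i j k a : i <= j -> j <= k -> k <= n ->
  triangle n i j k a = nth 0 [:: i; j; k] a :> nat.
Proof.
move=> ij jk kn; rewrite mk_deltaE.
by case: a => [[|[|[|a]]] la] //=; rewrite inordK; lia.
Qed.

Lemma d_triangle (X : sset) n (x : X n) i j k : i <= j -> j <= k -> k <= n ->
  [/\ d 0 (act (triangle n i j k) x) = act (edge n j k) x,
      d 2 (act (triangle n i j k) x) = act (edge n i j) x &
      d 1 (act (triangle n i j k) x) = act (edge n i k) x].
Proof.
move=> ij jk kn; have jn := leq_trans jk kn; have ik := leq_trans ij jk.
split; rewrite /d -act_comp; apply: act_eq => a;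
  by rewrite delta_compE triangleE // cofaceE edgeE //; case: (ord2P a) => ->.
Qed.

Lemma act_edge_refl (X : sset) n (x : X n) i : i <= n ->
  exists v : X 0, act (edge n i i) x = s 0 v.
Proof.
move=> i_n; exists (d 0 (act (edge n i i) x)).
rewrite /s /d -!act_comp; apply: act_eq => a.
by rewrite !delta_compE !edgeE //; do !case: ifP.
Qed.

(** * The isomorphism onto the nerve of the edge algebra *)

Section EdgeNerve.
Variable X : eset.
Hypothesis lift : frobenius_lifting X.
Local Notation F := (edge_frobenius lift).
Local Notation N := (nerve F).

Definition hom_of_simplex_fun n (x : X n) (p : chain n) : F :=
  act (edge n (sval p).1 (sval p).2) x.

Lemma hom_of_simplex1 n (x : X n) p :
  rone (chain n) tt p -> rone F tt (hom_of_simplex_fun x p).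
Proof.
rewrite /= /chain_one /hom_of_simplex_fun => ->.
by apply: act_edge_refl; rewrite -ltnS.
Qed.

Lemma hom_of_simplexM n (x : X n) p q r : rmul (chain n) (p, q) r ->
  rmul F (hom_of_simplex_fun x p, hom_of_simplex_fun x q) (hom_of_simplex_fun x r).
Proof.
case=> /= qp rq rp; rewrite /hom_of_simplex_fun rq rp -qp.
have := svalP q; have := svalP p; rewrite -qp => jk ij.
have kn : (sval p).2 <= n by rewrite -ltnS.
have [t0 t2 t1] := d_triangle x ij jk kn.
by exists (act (triangle n (sval q).1 (sval q).2 (sval p).2) x).
Qed.

Definition hom_of_simplex n (x : X n) : N n :=
  RMHom (@hom_of_simplex1 n x) (@hom_of_simplexM n x).

Lemma ev_hom_of_simplex n (x : X n) i j : i <= j -> j <= n ->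
  ev (hom_of_simplex x) i j = act (edge n i j) x.
Proof.
by move=> ij jn; rewrite evE /= /hom_of_simplex_fun edge_arrow1 ?edge_arrow2.
Qed.

Lemma hom_of_simplex_act m n (f : delta m n) (x : X n) :
  hom_of_simplex (act f x) = act f (hom_of_simplex x).
Proof.
apply: rmhom_ext => p; rewrite /= /hom_of_simplex_fun -act_comp.
have p2 : (sval p).2 <= m by rewrite -ltnS.
by rewrite edge_comp ?(svalP p) //= !inord_val.
Qed.

Lemma act_edge01 (x : X 1) : act (edge 1 0 1) x = x.
Proof. by rewrite -long_edge_edge long_edge1 act_id. Qed.

Lemma edge_val_hom_of_simplex (x : X 1) : edge_val (hom_of_simplex x) = x.
Proof. by rewrite -ev01 ev_hom_of_simplex // act_edge01. Qed.

(** Induction on the dimension: a vertex is a face of its degenerate edge, an edge is its own label,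
    triangles are determined by their edges, and higher simplices by their boundaries. *)
Lemma hom_of_simplex_inj n (x x' : X n) :
  hom_of_simplex x = hom_of_simplex x' -> x = x'.
Proof.
elim: n x x' => [|n IH] x x' xx'.
  have : d 0 (act (edge 0 0 0) x) = d 0 (act (edge 0 0 0) x').
    by rewrite -!ev_hom_of_simplex // xx'.
  by rewrite /d -!act_comp !act_idP // => a; congr nat_of_ord; rewrite [RHS]ord1 [LHS]ord1.
have dxx' i : d i x = d i x' by apply: IH; rewrite !hom_of_simplex_act xx'.
case: n {IH} x x' xx' dxx' => [|[|n]] x x' xx' dxx'.
- by rewrite -[x]edge_val_hom_of_simplex xx' edge_val_hom_of_simplex.
- exact: (triangle_inj lift).
- by apply: boundary_inj => //; case: lift => _ /(_ n.+3 isT).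
Qed.

Lemma hom_of_simplex_surj n (h : N n) : exists x, hom_of_simplex x = h.
Proof.
elim: n h => [|[|[|n]] IH] h.
- have [v hv] := ev_one h (leqnn 0); exists v; apply: ev_ext0.
  rewrite ev_hom_of_simplex // hv /s; apply: act_eq => a.
  by congr nat_of_ord; rewrite [RHS]ord1 [LHS]ord1.
- exists (edge_val h); apply: edge_val_inj; exact: edge_val_hom_of_simplex.
(* A product in [F] is by definition witnessed by a 2-simplex, which serves as preimage. *)
- have [t [/= t0 t2 t1]] := @ev_mul _ _ h 0 1 2 isT isT isT; exists t.
  have d_edge p i j : i <= j -> j <= 2 ->
      (forall a : 'I_2, bump p a = if a == ord0 then i else j) ->
      act (edge 2 i j) t = d p t.
    by move=> ij j2 pij; apply: act_eq => a; rewrite edgeE // cofaceE pij.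
  apply: ev_ext => // i j ij j2; rewrite ev_hom_of_simplex //; last exact: ltnW.
  have [i1|i1] := eqVneq i 1.
    have -> : j = 2 by lia.
    by rewrite i1 (d_edge 0) // => a; case: (ord2P a) => ->.
  have -> : i = 0 by lia.
  have [->|j1] := eqVneq j 1.
    by rewrite (d_edge 2) // => a; case: (ord2P a) => ->.
  have -> : j = 2 by lia.
  by rewrite (d_edge 1) // => a; case: (ord2P a) => ->.
- have /choice[y yh] i : exists z, hom_of_simplex z = d i h by exact: IH.
  have [_ /(_ n.+3 isT) bdry _] := lift.
  have [|x [xy _]] := (boundaryP X n.+1).1 bdry y.
    (* The preimages of the faces match because their images do, by injectivity one dimension
       lower. *)
    move=> i j ij jn _ _; apply: hom_of_simplex_inj.
    by rewrite !hom_of_simplex_act -!/(d _ _) !yh dd.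
  (* The image of the filler has the boundary of [h], and boundary fillers are unique in the nerve
     too. *)
  exists x; apply: boundary_inj; first by have [_ /(_ n.+3 isT)] := nerve_lifting F.
  by move=> i i_n; rewrite -[RHS]yh -xy // hom_of_simplex_act.
Qed.

Definition mark_of_mark (e : marks X) : marks N :=
  exist (fun a : F => rcounit F a tt) (mark_edge e) (ex_intro _ e erefl).

Lemma hom_of_simplex_edge e : hom_of_simplex (mark_edge e) = mark_edge (mark_of_mark e).
Proof. by apply: edge_val_inj; rewrite edge_val_hom_of_simplex mark_ev. Qed.

Theorem lifting_iso_nerve : eset_iso X N.
Proof.
pose f := @EMor X N hom_of_simplex mark_of_mark hom_of_simplex_act
  hom_of_simplex_edge.
apply: (@bijective_eset_iso X N f) => /=.
- exact: hom_of_simplex_inj.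
- exact: hom_of_simplex_surj.
- by move=> e e' /(congr1 sval) /= ee; apply: (mark_src_inj lift); rewrite ee.
- by move=> [a ea]; case: (ea) => e ea_e; exists e; apply: eq_exist.
Qed.

End EdgeNerve.

Theorem theorem7p2 (X : eset) :
  (exists F : frobenius, eset_iso X (nerve F)) <->
  [/\ forall n : nat, 1 <= n ->
        unique_extension_property X (sub_incl (@ehorn n ord0)) /\
        unique_extension_property X (sub_incl (@ehorn n ord_max)),
      forall n : nat, 3 <= n ->
        unique_extension_property X (sub_incl (boundary n))
    & extension_property X
        (sub_incl (sub_cup (@eface 4 (inord 1)) (@eface 4 (inord 3))))].
Proof.
split=> [[F [f [g [gf fg]]]]|lift].
  exact: (frobenius_lifting_iso gf (nerve_lifting F)).
by exists (edge_frobenius lift); exact: lifting_iso_nerve.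
Qed.
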